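(* Let $m\ge 1$ and $k\ge 0$ be integers. The level $k$ $C_2$-algebra $A_{[2]}(\mathfrak{sp}_{2m};k)$ and the level $k$ Zhu algebra $A(\mathfrak{sp}_{2m};k)$ have the same dimension: $$\dim A_{[2]}(\mathfrak{sp}_{2m};k)=\dim A(\mathfrak{sp}_{2m};k).$$
   Context: All Lie algebras are over $\mathbb C$. For a simple Lie algebra $\mathfrak g$ with highest root $\theta$, let $e_\theta\in\mathfrak g$ be a highest root vector (a highest weight vector of the adjoint representation). For an integer $k\ge 0$: - Zhu's algebra is $A(\mathfrak g;k)=\mathrm U(\mathfrak g)/\langle e_\theta^{k+1}\rangle$, the quotient of the universal enveloping algebra by the two-sided ideal generated by $e_\theta^{k+1}$. - The $C_2$-algebra is $A_{[2]}(\mathfrak g;k)=S^\bullet(\mathfrak g)/\langle \mathrm U(\mathfrak g)\circ e_\theta^{k+1}\rangle$, the quotient of the symmetric algebra $S^\bullet(\mathfrak g)$ by the ideal generated by the $\mathfrak g$-submodule $\mathrm U(\mathfrak g)\circ e_\theta^{k+1}\subset S^{k+1}(\mathfrak g)$ generated by $e_\theta^{k+1}\in S^{k+1}(\mathfrak g)$, where $\circ$ is the action of $\mathfrak g$ on $S^\bullet(\mathfrak g)$ induced by the adjoint action. *)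

(* Defs.v *)
From HB Require Import structures.
From mathcomp Require Import all_boot all_order all_algebra.
From mathcomp Require Import generic_quotient ring_quotient.
From mathcomp Require Import boolp ring.
(* The notations of monalg clash with those of mpoly. *)
From mathcomp Require monalg.
Import -(notations) monalg.
From mathcomp Require Import mpoly.

Set Implicit Arguments.
Unset Strict Implicit.
Unset Printing Implicit Defensive.

Import GRing.Theory.
Local Open Scope ring_scope.
Local Open Scope quotient_scope.

(* The dimension of a vector space is the cardinality of any of its bases, so
   two spaces have the same dimension when they have bases indexed by the same
   type; no finiteness is assumed. *)
Section Dimension.
Variable F : fieldType.

Definition lin_indep (V : lmodType F) (I : choiceType) (b : I -> V) : Prop :=
  forall (s : seq I) (a : I -> F), uniq s ->
    \sum_(i <- s) a i *: b i = 0 -> forall i, i \in s -> a i = 0.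

Definition spanning (V : lmodType F) (I : choiceType) (b : I -> V) : Prop :=
  forall v : V, exists (s : seq I) (a : I -> F), v = \sum_(i <- s) a i *: b i.

Definition is_basis (V : lmodType F) (I : choiceType) (b : I -> V) : Prop :=
  lin_indep b /\ spanning b.

Definition same_dim (V W : lmodType F) : Prop :=
  exists (I : choiceType) (b : I -> V) (c : I -> W), is_basis b /\ is_basis c.

End Dimension.

Section GeneratedIdeal.
Variables (F : fieldType) (A : algType F).

Definition two_sided_ideal (I : A -> Prop) : Prop :=
  [/\ I 0, forall x y, I x -> I y -> I (x + y),
      forall x y, I y -> I (x * y) & forall x y, I x -> I (x * y)].

Definition ideal_gen (S : A -> Prop) : A -> Prop := fun x =>
  forall I : A -> Prop, two_sided_ideal I -> (forall s, S s -> I s) -> I x.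

Lemma ideal_gen_ideal S : two_sided_ideal (ideal_gen S).
Proof.
split=> [I [] // | x y Sx Sy I HI SI | x y Sy I HI SI | x y Sx I HI SI].
- by case: (HI) => _ ID _ _; apply: ID; [apply: Sx | apply: Sy].
- by case: (HI) => _ _ IM _; apply: IM; apply: Sy.
- by case: (HI) => _ _ _ IM; apply: IM; apply: Sx.
Qed.

Lemma ideal_gen_sub S x : S x -> ideal_gen S x.
Proof. by move=> Sx I _; apply. Qed.

Definition ideal_pred (S : A -> Prop) : {pred A} := fun x => `[< ideal_gen S x >].

Lemma ideal_predP S x : reflect (ideal_gen S x) (x \in ideal_pred S).
Proof. exact: asboolP. Qed.

Lemma ideal_pred_zmod S : zmod_closed (ideal_pred S).
Proof.
have [I0 ID IM _] := ideal_gen_ideal S.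
split=> [|x y /ideal_predP Sx /ideal_predP Sy]; apply/ideal_predP => //.
by apply: ID => //; rewrite -mulN1r; apply: IM.
Qed.

HB.instance Definition _ S :=
  GRing.isZmodClosed.Build A (ideal_pred S) (ideal_pred_zmod S).

Definition quot_alg (S : A -> Prop) : Type := Quotient.quot (ideal_pred S).

Section Structure.
Variable S : A -> Prop.
Local Notation Q := (quot_alg S).
Local Notation J := (ideal_pred S).

HB.instance Definition _ := GRing.Zmodule.on Q.

Definition quot_pi (x : A) : Q := \pi_(Quotient.quot J) x.
Let rep (u : Q) : A := repr (u : Quotient.quot J).

Lemma quot_piP x y : (quot_pi x = quot_pi y) <-> ideal_gen S (x - y).
Proof.
split=> [/eqP|Sxy].
  by rewrite /quot_pi -Quotient.idealrBE => /ideal_predP.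
by apply/eqP; rewrite /quot_pi -Quotient.idealrBE; apply/ideal_predP.
Qed.

Let repK u : quot_pi (rep u) = u.
Proof. exact: reprK. Qed.

Lemma quot_pi_surj (u : Q) : exists x, u = quot_pi x.
Proof. by exists (rep u); rewrite repK. Qed.

Lemma quot_piD x y : quot_pi (x + y) = quot_pi x + quot_pi y.
Proof. by rewrite /quot_pi raddfD. Qed.

Lemma quot_pi0 : quot_pi 0 = 0.
Proof. by rewrite /quot_pi raddf0. Qed.

Lemma quot_piB x y : quot_pi (x - y) = quot_pi x - quot_pi y.
Proof. by rewrite /quot_pi raddfB. Qed.

Definition quot_one : Q := quot_pi 1.
Definition quot_mul (u v : Q) : Q := quot_pi (rep u * rep v).
Definition quot_scale (c : F) (u : Q) : Q := quot_pi (c *: rep u).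

Let rep_pi x : ideal_gen S (rep (quot_pi x) - x).
Proof. by apply/quot_piP; rewrite repK. Qed.

Lemma quot_mulE x y : quot_mul (quot_pi x) (quot_pi y) = quot_pi (x * y).
Proof.
have [_ ID IMl IMr] := ideal_gen_ideal S; apply/quot_piP.
set x' := rep _; set y' := rep _.
have -> : x' * y' - x * y = x' * (y' - y) + (x' - x) * y.
  by rewrite mulrBr mulrBl addrA subrK.
by apply: ID; [apply: IMl | apply: IMr]; apply: rep_pi.
Qed.

Lemma quot_scaleE c x : quot_scale c (quot_pi x) = quot_pi (c *: x).
Proof.
have [_ _ IMl _] := ideal_gen_ideal S; apply/quot_piP.
rewrite -scalerBr -[_ - _]mul1r scalerAl.
by apply: IMl; apply: rep_pi.
Qed.

Let quot_mulA : associative quot_mul.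
Proof.
by move=> u v w; rewrite -[u]repK -[v]repK -[w]repK !quot_mulE mulrA.
Qed.

Let quot_mul1 : left_id quot_one quot_mul.
Proof. by move=> u; rewrite -[u]repK quot_mulE mul1r. Qed.

Let quot_mulr1 : right_id quot_one quot_mul.
Proof. by move=> u; rewrite -[u]repK quot_mulE mulr1. Qed.

Let quot_mulDl : left_distributive quot_mul +%R.
Proof.
move=> u v w; rewrite -[u]repK -[v]repK -[w]repK.
by rewrite -quot_piD !quot_mulE mulrDl quot_piD.
Qed.

Let quot_mulDr : right_distributive quot_mul +%R.
Proof.
move=> u v w; rewrite -[u]repK -[v]repK -[w]repK.
by rewrite -quot_piD !quot_mulE mulrDr quot_piD.
Qed.

HB.instance Definition _ := GRing.Zmodule_isPzRing.Build Q
  quot_mulA quot_mul1 quot_mulr1 quot_mulDl quot_mulDr.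

Let quot_scaleA c d u : quot_scale c (quot_scale d u) = quot_scale (c * d) u.
Proof. by rewrite -[u]repK !quot_scaleE scalerA. Qed.

Let quot_scale1 : left_id 1 quot_scale.
Proof. by move=> u; rewrite -[u]repK quot_scaleE scale1r. Qed.

Let quot_scaleDr : right_distributive quot_scale +%R.
Proof.
move=> c u v; rewrite -[u]repK -[v]repK.
by rewrite -quot_piD !quot_scaleE scalerDr quot_piD.
Qed.

Let quot_scaleDl u : {morph quot_scale^~ u : c d / c + d}.
Proof. by move=> c d; rewrite -[u]repK !quot_scaleE scalerDl quot_piD. Qed.

HB.instance Definition _ := GRing.Zmodule_isLmodule.Build F Q
  quot_scaleA quot_scale1 quot_scaleDr quot_scaleDl.

Lemma quot_piM x y : quot_pi (x * y) = quot_pi x * quot_pi y.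
Proof. by rewrite -quot_mulE. Qed.

Lemma quot_piZ c x : quot_pi (c *: x) = c *: quot_pi x.
Proof. by rewrite -quot_scaleE. Qed.

Lemma quot_pi1 : quot_pi 1 = 1.
Proof. by []. Qed.

Lemma quot_scaleAl c (u v : Q) : c *: (u * v) = (c *: u) * v.
Proof.
rewrite -[u]repK -[v]repK.
by rewrite -quot_piM -!quot_piZ -quot_piM scalerAl.
Qed.

Lemma quot_scaleAr c (u v : Q) : c *: (u * v) = u * (c *: v).
Proof.
rewrite -[u]repK -[v]repK.
by rewrite -quot_piM -!quot_piZ -quot_piM scalerAr.
Qed.

End Structure.
End GeneratedIdeal.

HB.mixin Record isLieAlg (F : fieldType) L of Vector F L := {
  bracket : L -> L -> L;
  bracket_linearl : forall (a : F) (x y z : L),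
    bracket (a *: x + y) z = a *: bracket x z + bracket y z;
  bracket_linearr : forall (a : F) (x y z : L),
    bracket z (a *: x + y) = a *: bracket z x + bracket z y;
  bracketxx : forall x : L, bracket x x = 0;
  jacobi : forall x y z : L,
    bracket x (bracket y z) + bracket y (bracket z x)
      + bracket z (bracket x y) = 0
}.

#[short(type="lieAlgType")]
HB.structure Definition LieAlg (F : fieldType) := { L of isLieAlg F L & Vector F L }.

Lemma malg_scaleAr (R : comNzRingType) (K : monalg.MonomialDef.type) (c : R)
    (x y : monalg.malg K R) : c *: (x * y) = x * (c *: y).
Proof.
apply/monalg.malgP => k; rewrite monalg.mcoeffZ monalg.mcoeffMl.
rewrite (@monalg.mcoeffMlw _ _ (monalg.msupp x) (monalg.msupp y)) //; last first.
  exact: monalg.msuppZ_le.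
rewrite mulr_sumr; apply: eq_bigr => i _; rewrite mulr_sumr.
by apply: eq_bigr => j _; rewrite monalg.mcoeffZ mulrnAr mulrCA.
Qed.

Section FreeAlgebra.
Variables (F : fieldType) (I : choiceType).

Definition malg_alg : Type := monalg.malg (monalg.fmonom I) F.
HB.instance Definition _ := GRing.Lalgebra.on malg_alg.
HB.instance Definition _ := GRing.Lalgebra_isAlgebra.Build F malg_alg
  (@malg_scaleAr _ _).

(* The monoid algebra of the free monoid on I, with its generators. It is locked
   because failing conversion tests unfold the operations of malg at length. *)
Definition free_alg_pack : {A : algType F & I -> A} :=
  locked (existT (fun A : algType F => I -> A) (malg_alg : algType F)
    (fun i => monalg.mkmalgU (monalg.fmu i) 1)).

Definition free_alg : algType F := projT1 free_alg_pack.
Definition free_gen : I -> free_alg := projT2 free_alg_pack.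

Lemma free_alg_augmentation :
  exists eps : {rmorphism free_alg -> F},
    (forall (c : F) x, eps (c *: x) = c * eps x) /\ forall i, eps (free_gen i) = 0.
Proof.
rewrite /free_gen /free_alg /free_alg_pack -lock /=.
pose eps : {rmorphism malg_alg -> F} :=
  monalg.mcoeff (monalg.one : monalg.fmonom I) :> (monalg.malg _ F -> F).
exists eps; split=> [c x|i]; first exact: monalg.mcoeffZ.
rewrite /= monalg.mcoeffU.
have /negbTE -> // : monalg.fmu i != monalg.one.
by apply/eqP => /(congr1 (@monalg.fdeg _)); rewrite monalg.fdegU monalg.fdeg1.
Qed.

End FreeAlgebra.

Section Enveloping.
Variables (F : fieldType) (L : lieAlgType F).
Local Notation n := (\dim {:L}).
Local Notation b := (vbasis {:L}).

(* The tensor algebra T(L): the free associative algebra on the vectors of the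
   basis [b] of [L]. *)
Definition tensor_alg : algType F := free_alg F 'I_n.

Definition tensor_in (x : L) : tensor_alg :=
  \sum_(i < n) coord b i x *: free_gen F i.

Definition env_rel (t : tensor_alg) : Prop :=
  exists x y : L, t = tensor_in x * tensor_in y - tensor_in y * tensor_in x
                      - tensor_in (bracket x y).

Definition env_alg : Type := quot_alg env_rel.
HB.instance Definition _ := GRing.PzRing.on env_alg.
HB.instance Definition _ := GRing.Lmodule.on env_alg.

(* The kernel of the augmentation T(L) -> F contains the relations. *)
Let env_alg_nonzero : (1 : env_alg) != 0.
Proof.
have [eps [epsZ eps_gen]] := free_alg_augmentation F 'I_n.
have eps_in x : eps (tensor_in x) = 0.
  by rewrite /tensor_in raddf_sum big1 // => i _; rewrite /= epsZ eps_gen mulr0.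
apply/eqP => H1; have {H1} H : ideal_gen env_rel (1 - 0).
  by apply/quot_piP; rewrite quot_pi0 quot_pi1.
have: eps (1 - 0) = 0; last by rewrite subr0 rmorph1 => /eqP; rewrite oner_eq0.
apply: (H (fun t => eps t = 0)) => [|_ [x [y ->]]]; last first.
  by rewrite !rmorphB !rmorphM !eps_in mulr0 !subr0.
split=> [|x y x0 y0|x y y0|x y x0]; rewrite ?rmorph0 ?rmorphD ?rmorphM //.
- by rewrite x0 y0 addr0.
- by rewrite y0 mulr0.
- by rewrite x0 mul0r.
Qed.

HB.instance Definition _ := GRing.PzSemiRing_isNonZero.Build env_alg env_alg_nonzero.
HB.instance Definition _ :=
  GRing.Lmodule_isLalgebra.Build F env_alg (@quot_scaleAl _ _ env_rel).
HB.instance Definition _ :=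
  GRing.Lalgebra_isAlgebra.Build F env_alg (@quot_scaleAr _ _ env_rel).

Definition env_in (x : L) : env_alg := quot_pi env_rel (tensor_in x).

Lemma env_in_bracket x y :
  env_in (bracket x y) = env_in x * env_in y - env_in y * env_in x.
Proof.
have : ideal_gen env_rel (tensor_in x * tensor_in y - tensor_in y * tensor_in x
    - tensor_in (bracket x y)) by apply: ideal_gen_sub; exists x, y.
rewrite /env_in.
move: (tensor_in x) (tensor_in y) (tensor_in (bracket x y)) => t u v.
by move=> /quot_piP; rewrite quot_piB !quot_piM => ->.
Qed.

(* The symmetric algebra S(L): polynomials in the vectors of the basis [b]. *)
Local Notation sym_alg := {mpoly F[n]}.

Definition sym_in (x : L) : sym_alg := \sum_(i < n) coord b i x *: 'X_i.

(* The action of [x] on S(L): the derivation extending ad x. *)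
Definition sym_act (x : L) (p : sym_alg) : sym_alg :=
  \sum_(i < n) sym_in (bracket x b`_i) * mderiv i p.

Lemma sym_actM x p q : sym_act x (p * q) = sym_act x p * q + p * sym_act x q.
Proof.
rewrite /sym_act mulr_suml mulr_sumr -big_split; apply: eq_bigr => i _ /=.
by rewrite mderivM mulrDr -mulrA (mulrCA _ p).
Qed.

Lemma sym_act_linear x (a : F) p q :
  sym_act x (a *: p + q) = a *: sym_act x p + sym_act x q.
Proof.
rewrite /sym_act scaler_sumr -big_split; apply: eq_bigr => i _ /=.
by rewrite linearP mulrDr -scalerAr.
Qed.

Lemma sym_in_linear (a : F) x y : sym_in (a *: x + y) = a *: sym_in x + sym_in y.
Proof.
rewrite /sym_in scaler_sumr -big_split; apply: eq_bigr => i _ /=.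
by rewrite linearP scalerDl scalerA.
Qed.

Lemma sym_act_in x y : sym_act x (sym_in y) = sym_in (bracket x y).
Proof.
have brsum (r : seq 'I_n) (a : 'I_n -> F) :
  sym_in (bracket x (\sum_(i <- r) a i *: b`_i)) =
  \sum_(i <- r) a i *: sym_in (bracket x b`_i).
  have br0 : bracket x 0 = 0.
    by have := bracket_linearr (-1) 0 0 x; rewrite scaler0 addr0 scaleN1r addNr.
  have in0 : sym_in 0 = 0.
    by rewrite /sym_in big1 // => i _; rewrite linear0 scale0r.
  elim: r => [|i r IH]; first by rewrite !big_nil br0.
  by rewrite !big_cons bracket_linearr sym_in_linear IH.
rewrite [in RHS](coord_vbasis (memvf y)) brsum /sym_act.
apply: eq_bigr => i _; rewrite -mul_mpolyC mulrC; congr (_ * _).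
rewrite /sym_in linear_sum (bigD1 i) //= linearZ /= big1 => [|j ji].
  rewrite addr0 mderivX mnm1E eqxx -mul_mpolyC scale1r.
  by rewrite -[X in (X - _)%MM]add0m addmK mpolyX0 mulr1.
by rewrite linearZ /= mderivX mnm1E (negbTE ji) scale0r scaler0.
Qed.

Definition is_submodule (W : sym_alg -> Prop) : Prop :=
  [/\ W 0, forall (a : F) p q, W p -> W q -> W (a *: p + q)
    & forall x p, W p -> W (sym_act x p)].

(* The L-submodule U(L) o v generated by v. *)
Definition submodule_gen (v : sym_alg) : sym_alg -> Prop := fun p =>
  forall W : sym_alg -> Prop, is_submodule W -> W v -> W p.

(* Zhu's algebra U(L)/<e^(k+1)>; the intended [e] is a highest root vector. *)
Definition zhu_alg (e : L) (k : nat) : Type :=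
  quot_alg (fun u : env_alg => u = env_in e ^+ k.+1).
HB.instance Definition _ e k := GRing.PzRing.on (zhu_alg e k).
HB.instance Definition _ e k := GRing.Lmodule.on (zhu_alg e k).

(* The C_2-algebra S(L)/<U(L) o e^(k+1)>. *)
Definition c2_alg (e : L) (k : nat) : Type :=
  quot_alg (submodule_gen (sym_in e ^+ k.+1)).
HB.instance Definition _ e k := GRing.PzRing.on (c2_alg e k).
HB.instance Definition _ e k := GRing.Lmodule.on (c2_alg e k).

(* [e] is a highest weight vector of the adjoint representation for the Cartan
   subalgebra [h] and the nilradical [np] of a Borel subalgebra containing it. *)
Definition adjoint_hwv (h np : L -> Prop) (e : L) : Prop :=
  [/\ e != 0,
      exists weight : L -> F, forall x, h x -> bracket x e = weight x *: e
    & forall x, np x -> bracket x e = 0].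

End Enveloping.

Section Symplectic.
Variables (F : fieldType) (m : nat).
Local Notation M := 'M[F]_(m + m).

Definition sympl_form : M := block_mx 0 1%:M (- 1%:M) 0.

Definition sp_defect (X : M) : M := X^T *m sympl_form + sympl_form *m X.

Let sp_defect_linear : linear sp_defect.
Proof.
move=> a X Y; rewrite /sp_defect linearP /= mulmxDl mulmxDr scalerDr.
by rewrite -scalemxAl -scalemxAr addrACA.
Qed.

HB.instance Definition _ := GRing.isLinear.Build F M M _ sp_defect sp_defect_linear.

Definition sp_space : {vspace M} := lker (linfun sp_defect).

Lemma mem_sp X : (X \in sp_space) = (X^T *m sympl_form + sympl_form *m X == 0).
Proof. by rewrite memv_ker lfunE. Qed.

Definition sp : Type := subvs_of sp_space.
HB.instance Definition _ := Vector.on sp.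

Definition sp_mx (x : sp) : M := vsval x.

Definition commutator (X Y : M) : M := X *m Y - Y *m X.

Lemma sp_mxE (x : sp) : (sp_mx x)^T *m sympl_form = - (sympl_form *m sp_mx x).
Proof. by apply/eqP; rewrite -addr_eq0 -mem_sp; apply: valP. Qed.

Lemma commutator_sp (x y : sp) : commutator (sp_mx x) (sp_mx y) \in sp_space.
Proof.
move: (sp_mxE x) (sp_mxE y); move: (sp_mx x) (sp_mx y) => X Y HX HY.
rewrite /commutator mem_sp addr_eq0 linearB /= !trmx_mul mulmxBl mulmxBr.
rewrite -!mulmxA HX HY !mulmxN !mulmxA HX HY.
by rewrite !mulNmx !opprK opprB.
Qed.

Definition sp_bracket (x y : sp) : sp :=
  vsproj sp_space (commutator (sp_mx x) (sp_mx y)).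

Lemma sp_bracketE x y : sp_mx (sp_bracket x y) = commutator (sp_mx x) (sp_mx y).
Proof. by rewrite /sp_mx vsprojK ?commutator_sp. Qed.

Let sp_mx_inj : injective sp_mx.
Proof. exact: val_inj. Qed.

Let sp_mxP a x y : sp_mx (a *: x + y) = a *: sp_mx x + sp_mx y.
Proof. by rewrite /sp_mx linearP. Qed.

Let sp_bracket_linearl a x y z :
  sp_bracket (a *: x + y) z = a *: sp_bracket x z + sp_bracket y z.
Proof.
apply: sp_mx_inj; rewrite sp_mxP !sp_bracketE sp_mxP /commutator.
rewrite mulmxDl mulmxDr -scalemxAl -scalemxAr scalerBr opprD.
by rewrite addrACA.
Qed.

Let sp_bracketxx x : sp_bracket x x = 0.
Proof. by apply: sp_mx_inj; rewrite sp_bracketE /commutator subrr /sp_mx linear0. Qed.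

Let sp_bracket_linearr a x y z :
  sp_bracket z (a *: x + y) = a *: sp_bracket z x + sp_bracket z y.
Proof.
apply: sp_mx_inj; rewrite sp_mxP !sp_bracketE sp_mxP /commutator.
rewrite mulmxDl mulmxDr -scalemxAl -scalemxAr scalerBr opprD.
by rewrite addrACA.
Qed.

Let sp_jacobi x y z :
  sp_bracket x (sp_bracket y z) + sp_bracket y (sp_bracket z x)
    + sp_bracket z (sp_bracket x y) = 0.
Proof.
have mxD u v : sp_mx (u + v) = sp_mx u + sp_mx v by rewrite /sp_mx linearD.
apply: sp_mx_inj; rewrite !mxD !sp_bracketE /commutator.
move: (sp_mx x) (sp_mx y) (sp_mx z) => X Y Z; rewrite {x y z}/sp_mx linear0.
rewrite !mulmxBr !mulmxBl !mulmxA.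
apply/matrixP => i j; rewrite !mxE.
ring.
Qed.

HB.instance Definition _ := isLieAlg.Build F sp
  sp_bracket_linearl sp_bracket_linearr sp_bracketxx sp_jacobi.

(* The diagonal Cartan subalgebra, and the sum of the root spaces of the
   positive roots e_i - e_j (i < j), e_i + e_j and 2e_i. *)
Definition sp_cartan (x : sp) : Prop := is_diag_mx (sp_mx x).

Definition sp_npos (x : sp) : Prop :=
  dlsubmx (sp_mx x) = 0 /\
  forall i j : 'I_m, (j <= i)%N -> ulsubmx (sp_mx x) i j = 0.

Definition highest_root_vector (e : sp) : Prop := adjoint_hwv sp_cartan sp_npos e.

End Symplectic.

(* Main.v *)
From HB Require Import structures.
Require Import Defs.
From mathcomp Require Import all_boot all_order all_algebra finmap.
From mathcomp Require Import boolp zify ring.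
From mathcomp Require monalg.
Import -(notations) monalg.
From mathcomp Require Import mpoly.
From mathcomp Require Import reals complex.

Set Implicit Arguments.
Unset Strict Implicit.
Unset Printing Implicit Defensive.

Import GRing.Theory Num.Theory.
Local Open Scope ring_scope.

(* Write L = sp(V) with V = C^(2m), and let V + V carry the difference of the two
   symplectic forms, so that the diagonal is Lagrangian. The Siegel parabolic
   stabilizing it has Levi factor gl(V), its opposite has an abelian nilradical
   isomorphic to L as a vector space, and the module induced from the character
   k tr of gl(V) is S(L). The first factor of sp(V) + sp(V) is a complement of
   the parabolic; a vector x of this factor acts on S(L) by
     x + (gl x) / 2 + (dop x) / 4,
   a multiplication by x followed by terms that do not raise degrees.

   For the character k tr the ideal J defining the C_2-algebra is a submodule.
   The operator of e in the first factor is conjugate, under exp (dop h / 2) for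
   a suitable h in sp(V), to the multiplication by e, so its power k+1 maps S(L)
   into J. Hence u |-> u.1 induces a map from the Zhu algebra to the C_2-algebra,
   which is onto because u.1 has the symbol of u as its leading form. It is
   injective because the symbols of the elements of <e^(k+1)> contain J. *)

(** * Linearity as a property of functions *)

Section LinearProp.
Variables (F : fieldType) (V W : lmodType F) (f : V -> W).
Hypothesis fl : linear f.

Lemma lin0 : f 0 = 0.
Proof. by have := fl (-1) 0 0; rewrite scaler0 addr0 scaleN1r addNr. Qed.

Lemma linD x y : f (x + y) = f x + f y.
Proof. by have := fl 1 x y; rewrite !scale1r. Qed.

Lemma linZ a x : f (a *: x) = a *: f x.
Proof. by have := fl a x 0; rewrite lin0 !addr0. Qed.

Lemma linN x : f (- x) = - f x.
Proof. by rewrite -scaleN1r linZ scaleN1r. Qed.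

Lemma linB x y : f (x - y) = f x - f y.
Proof. by rewrite linD linN. Qed.

Lemma lin_sum (I : Type) (s : seq I) (E : I -> V) :
  f (\sum_(i <- s) E i) = \sum_(i <- s) f (E i).
Proof. exact: (big_morph f linD lin0). Qed.

End LinearProp.

(** * Bases *)

Section BasisExtraction.
Variable F : fieldType.

Definition lin_closed (V : lmodType F) (K : V -> Prop) : Prop :=
  K 0 /\ forall (a : F) x y, K x -> K y -> K (a *: x + y).

Lemma lin_closed_sum (V : lmodType F) (K : V -> Prop) (I : eqType) (s : seq I)
    (P : pred I) (a : I -> F) (v : I -> V) :
  lin_closed K -> (forall i, i \in s -> P i -> K (v i)) ->
  K (\sum_(i <- s | P i) a i *: v i).
Proof.
move=> [K0 KD] Kv; rewrite big_seq_cond.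
by apply: big_rec => [//|i x /andP[si Pi] Kx]; apply: KD => //; apply: Kv.
Qed.

(** Indices may repeat in the lists of [spanning]. Their multiplicities are moved into the
    coefficients, so that two combinations can be added over one common list. *)
Lemma sum_uniq_superset (V : lmodType F) (I : eqType) (v : I -> V) (a : I -> F)
    (s t : seq I) : uniq t -> {subset s <= t} ->
  \sum_(i <- s) a i *: v i = \sum_(i <- t) (a i *+ count_mem i s) *: v i.
Proof.
move=> tU; elim: s => [|j s IH] st.
  by rewrite big_nil big1 // => i _; rewrite mulr0n scale0r.
have jt : j \in t by apply: st; rewrite mem_head.
rewrite big_cons IH => [|i si]; last by apply: st; rewrite inE si orbT.
transitivity (\sum_(i <- t) ((a i *+ (j == i)) *: v i + (a i *+ count_mem i s) *: v i)).
  rewrite big_split /=; congr (_ + _).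
  rewrite (bigD1_seq j) //= eqxx mulr1n big1 ?addr0 // => i ij.
  by rewrite eq_sym (negbTE ij) mulr0n scale0r.
by apply: eq_bigr => i _; rewrite -scalerDl -mulrnDr.
Qed.

Lemma lin_closed_span (V : lmodType F) (I : choiceType) (v : I -> V) :
  lin_closed (fun w => exists (s : seq I) (a : I -> F), w = \sum_(i <- s) a i *: v i).
Proof.
split=> [|c x y [s1 [a1 ->]] [s2 [a2 ->]]].
  by exists [::], (fun=> 0); rewrite big_nil.
pose t := undup (s1 ++ s2).
have tU : uniq t by apply: undup_uniq.
exists t, (fun i => c * (a1 i *+ count_mem i s1) + a2 i *+ count_mem i s2).
have s1t : {subset s1 <= t} by move=> i si; rewrite mem_undup mem_cat si.
have s2t : {subset s2 <= t} by move=> i si; rewrite mem_undup mem_cat si orbT.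
rewrite (sum_uniq_superset _ _ tU s1t) (sum_uniq_superset _ _ tU s2t).
rewrite scaler_sumr -big_split; apply: eq_bigr => i _ /=.
by rewrite scalerDl scalerA.
Qed.

(* Greedy extraction: keep the vectors that do not lie in the span of their
   predecessors. *)
Lemma basis_of_sequence (V : lmodType F) (v : nat -> V) :
  (forall K : V -> Prop, lin_closed K -> (forall n, K (v n)) -> forall w, K w) ->
  exists (I : choiceType) (f : I -> nat), is_basis (fun i => v (f i)).
Proof.
move=> vV.
(* The span of the predecessors is encoded as the intersection of all subspaces that contain
   them. *)
pose old n := forall K : V -> Prop, lin_closed K ->
  (forall j, (j < n)%N -> K (v j)) -> K (v n).
pose I : choiceType := {n : nat | `[< ~ old n >]}.
exists I, (fun i : I => val i); split=> [s a sU s0|w]; last first.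
  apply: (vV (fun w => exists (s : seq I) (a : I -> F),
    w = \sum_(i <- s) a i *: v (val i))) => [|n]; first exact: lin_closed_span.
  elim/ltn_ind: n => n IH.
  case: (pselect (old n)) => [oldn|newn].
    apply: (oldn (fun w => exists (s : seq I) (a : I -> F),
      w = \sum_(i <- s) a i *: v (val i))) => //; exact: lin_closed_span.
  have Pn : `[< ~ old n >] by apply/asboolP.
  exists [:: exist _ n Pn : I], (fun=> 1).
  by rewrite big_cons big_nil addr0 scale1r.
pose N := (\sum_(i <- s) val i)%N.
have leN i : i \in s -> (val i <= N)%N.
  by move=> si; rewrite /N (big_rem i si) /= leq_addr.
(* Coefficients vanish from the largest index down: if [a i] were nonzero while all later
   coefficients vanish, [v (val i)] would lie in the span of its predecessors. The induction is on
   the distance from [val i] to [N]. *)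
suff H d i : i \in s -> (N - val i < d)%N -> a i = 0.
  by move=> i si; apply: (H (N - val i).+1).
elim: d i => // d IH i si Hd; apply/eqP/negP => /negP ai0.
have /asboolP := valP i; apply=> K [K0 KD] Kv.
have -> : v (val i) = (- (a i)^-1) *: \sum_(j <- s | j != i) a j *: v (val j) + 0.
  move: s0; rewrite (bigD1_seq i) //= => /eqP; rewrite addr_eq0 => /eqP s0.
  by rewrite addr0 scaleNr -scalerN -s0 scalerA mulVf ?scale1r.
apply: (KD _ _ _ _ K0); rewrite big_seq_cond.
apply: big_rec => [//|j x /andP[sj ji] Kx].
have [ltji|leij] := ltnP (val j) (val i); first by apply: (KD _ _ _ _ Kx); apply: Kv.
rewrite (IH j) // ?scale0r ?add0r //.
have : val i != val j by rewrite (inj_eq val_inj) eq_sym.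
have := leN j sj; move: Hd leij; lia.
Qed.

(** Both spaces are the quotient of [X] by the common kernel of [f] and [g]. A basis of [V]
    extracted from [v] is lifted to [X] and pushed down to [W]. *)
Lemma same_dim_of_surjections (X V W : lmodType F) (f : X -> V)
    (g : X -> W) (v : nat -> V) :
  linear f -> linear g ->
  (forall y, exists x, y = f x) -> (forall z, exists x, z = g x) ->
  (forall x, f x = 0 <-> g x = 0) ->
  (forall K : V -> Prop, lin_closed K -> (forall n, K (v n)) -> forall w, K w) ->
  same_dim V W.
Proof.
move=> fl gl.
have [{}f -> {fl}] : exists f' : {linear X -> V}, f = f' :> (X -> V).
  pose f' : {linear X -> V} := HB.pack f (GRing.isLinear.Build F X V _ f fl).
  by exists f'.
have [{}g -> {gl}] : exists g' : {linear X -> W}, g = g' :> (X -> W).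
  pose g' : {linear X -> W} := HB.pack g (GRing.isLinear.Build F X W _ g gl).
  by exists g'.
move=> fS gS fg0 vV; have [I [h [hfree hspan]]] := basis_of_sequence vV.
have lift n : {x | v n = f x} by apply: cid; apply: fS.
have fE n : f (sval (lift n)) = v n by case: (lift n).
exists I, (fun i => v (h i)), (fun i => g (sval (lift (h i)))).
have fsum (s : seq I) a : f (\sum_(i <- s) a i *: sval (lift (h i))) =
    \sum_(i <- s) a i *: v (h i).
  by rewrite linear_sum; apply: eq_bigr => i _; rewrite linearZ /= fE.
have gsum (s : seq I) a : g (\sum_(i <- s) a i *: sval (lift (h i))) =
    \sum_(i <- s) a i *: g (sval (lift (h i))).
  by rewrite linear_sum; apply: eq_bigr => i _; rewrite linearZ.
split; split=> // [s a sU|w].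
  by rewrite -gsum => /fg0; rewrite fsum; apply: hfree.
have [x ->] := gS w; have [s [a fx]] := hspan (f x).
exists s, a; rewrite -gsum; apply/eqP; rewrite -subr_eq0 -linearB; apply/eqP.
by apply/fg0; rewrite linearB /= fsum fx subrr.
Qed.

End BasisExtraction.

(** * Universal property of the enveloping algebra *)

(** The first hypothesis says that the [g i] span [A] linearly, so multiplicativity on pairs of them
    extends by bilinearity. *)
Lemma bilinear_actM (F : fieldType) (A : algType F) (V : lmodType F)
    (T : A -> V -> V) (I : Type) (g : I -> A) :
  (forall P : A -> Prop, P 0 -> (forall a x y, P x -> P y -> P (a *: x + y)) ->
    (forall i, P (g i)) -> forall x, P x) ->
  (forall v, linear (T^~ v)) -> (forall x, linear (T x)) ->
  (forall i j v, T (g i * g j) v = T (g i) (T (g j) v)) ->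
  forall x y v, T (x * y) v = T x (T y v).
Proof.
move=> ind Tl Tr TM.
have T0 w : T 0 w = 0.
  by have := Tl w (-1) 0 0; rewrite scaler0 addr0 scaleN1r addNr.
have T0r z : T z 0 = 0.
  by have := Tr z (-1) 0 0; rewrite scaler0 addr0 scaleN1r addNr.
move=> x y v; move: x; apply: (ind _) => [|a x z IHx IHz|i].
- by rewrite mul0r !T0.
- by rewrite mulrDl -scalerAl !Tl IHx IHz.
move: y; apply: (ind _) => [|a x z IHx IHz|j //].
- by rewrite mulr0 !T0 T0r.
- by rewrite mulrDr -scalerAr !Tl Tr IHx IHz.
Qed.

(** * Modules over the free associative algebra *)

Section FreeAlgebraTheory.
Variables (F : fieldType) (I : choiceType).
Local Notation M := (monalg.fmonom I).

Let U (k : M) : malg_alg F I := monalg.mkmalgU k 1.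

Let UM k l : U k * U l = U (monalg.mul k l).
Proof. by rewrite [LHS]monalg.malgM_def monalg.fgmulUU mulr1. Qed.

Let malg_lin_ind (P : malg_alg F I -> Prop) :
  P 0 -> (forall a x y, P x -> P y -> P (a *: x + y)) ->
  (forall k, P (U k)) -> forall x, P x.
Proof.
move=> P0 PD PU x; rewrite [x]monalg.monalgE.
apply: big_ind => [//|y z Py Pz|k _]; first by rewrite -[y]scale1r; apply: PD.
have -> : monalg.mkmalgU k (monalg.mcoeff k x) =
          monalg.mcoeff k x *: U k + 0 :> malg_alg F I.
  rewrite addr0; apply/monalg.malgP => l.
  by rewrite monalg.mcoeffZ !monalg.mcoeffU; case: eqP => _; rewrite ?mulr1 ?mulr0.
exact: PD.
Qed.

Let malg_ind (P : malg_alg F I -> Prop) :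
  P 0 -> (forall a x y, P x -> P y -> P (a *: x + y)) -> P 1 ->
  (forall i x, P x -> P (U (monalg.fmu i) * x)) -> forall x, P x.
Proof.
move=> P0 PD P1 PM; apply: malg_lin_ind => // -[s]; elim: s => [|i s IH].
  by rewrite -monalg.fmoneE.
have -> : monalg.FMonom (i :: s) = monalg.fmmul (monalg.fmu i) (monalg.FMonom s).
  by rewrite monalg.fmmulE monalg.fmuE.
by rewrite -UM; apply: PM.
Qed.

Lemma free_alg_ind (P : free_alg F I -> Prop) :
  P 0 -> (forall a x y, P x -> P y -> P (a *: x + y)) -> P 1 ->
  (forall i x, P x -> P (free_gen F i * x)) -> forall x, P x.
Proof.
move: P; rewrite /free_gen /free_alg /free_alg_pack -lock /=.
exact: malg_ind.
Qed.

Section Action.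
Variables (V : lmodType F) (r : I -> V -> V).
Hypothesis rP : forall i, linear (r i).

Let word (k : M) (v : V) : V := foldr r v k.
Let ev (x : malg_alg F I) (v : V) : V :=
  \sum_(k <- monalg.msupp x) monalg.mcoeff k x *: word k v.

Let evEw (d : {fset M}) x v : (monalg.msupp x `<=` d)%fset ->
  ev x v = \sum_(k <- d) monalg.mcoeff k x *: word k v.
Proof.
move=> le; rewrite [LHS](big_fset_incl _ le) => //= k _ /monalg.mcoeff_outdom ->.
by rewrite scale0r.
Qed.

Let ev_linear v : linear (ev^~ v).
Proof.
move=> a x y.
pose d := (monalg.msupp (a *: x + y) `|` (monalg.msupp x `|` monalg.msupp y))%fset.
rewrite !(@evEw d) /d ?fsubsetUl //; last first.
- by rewrite fsetUCA fsubsetUl.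
- by rewrite fsetUA fsubsetUr.
rewrite scaler_sumr -big_split; apply: eq_bigr => k _ /=.
by rewrite monalg.mcoeffD monalg.mcoeffZ scalerDl scalerA.
Qed.

Let word_linear k : linear (word k).
Proof.
case: k => s a u v; rewrite /word /=; elim: s => //= i s ->; exact: rP.
Qed.

Let evU k v : ev (U k) v = word k v.
Proof.
by rewrite (evEw _ monalg.msuppU_le) big_seq_fset1 monalg.mcoeffUU scale1r.
Qed.

Let ev_linearr x : linear (ev x).
Proof.
move=> a u v; rewrite /ev scaler_sumr -big_split; apply: eq_bigr => k _ /=.
by rewrite word_linear scalerDr !scalerA mulrC.
Qed.

Let evM x y v : ev (x * y) v = ev x (ev y v).
Proof.
apply: (@bilinear_actM F (malg_alg F I) V ev M U malg_lin_ind) => // k l w.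
by rewrite UM !evU /word monalg.fmM foldr_cat.
Qed.

Let ev1 v : ev 1 v = v.
Proof. by rewrite [1]/(U monalg.one) evU /word monalg.fm1. Qed.

Let ev_gen i v : ev (U (monalg.fmu i)) v = r i v.
Proof. by rewrite evU /word monalg.fmU. Qed.

Lemma free_alg_action : exists T : free_alg F I -> V -> V,
  [/\ forall v, linear (T^~ v), forall x, linear (T x), forall v, T 1 v = v,
      forall x y v, T (x * y) v = T x (T y v)
    & forall i v, T (free_gen F i) v = r i v].
Proof.
rewrite /free_gen /free_alg /free_alg_pack -lock /=.
by exists ev; split.
Qed.

End Action.
End FreeAlgebraTheory.

(** * Modules over the enveloping algebra *)

Section EnvelopingTheory.
Variables (F : fieldType) (L : lieAlgType F).
Local Notation U := (env_alg L).
Local Notation b := (vbasis {:L}).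

Lemma tensor_in_linear (a : F) (x y : L) :
  tensor_in (a *: x + y) = a *: tensor_in x + tensor_in y.
Proof.
rewrite /tensor_in scaler_sumr -big_split; apply: eq_bigr => i _ /=.
by rewrite linearP scalerDl scalerA.
Qed.

Lemma tensor_in_basis (i : 'I_(\dim {:L})) : tensor_in b`_i = free_gen F i.
Proof.
rewrite /tensor_in (bigD1 i) //= big1 => [|j ji].
  by rewrite coord_free ?(basis_free (vbasisP _)) // eqxx scale1r addr0.
by rewrite coord_free ?(basis_free (vbasisP _)) // eq_sym (negbTE ji) scale0r.
Qed.

Lemma env_in_linear (a : F) (x y : L) :
  env_in (a *: x + y) = a *: env_in x + env_in y.
Proof. by rewrite /env_in tensor_in_linear quot_piD quot_piZ. Qed.

Lemma env_ind (P : U -> Prop) :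
  P 0 -> (forall a x y, P x -> P y -> P (a *: x + y)) -> P 1 ->
  (forall (x : L) u, P u -> P (env_in x * u)) -> forall u, P u.
Proof.
move=> P0 PD P1 PM u; have [t ->] := quot_pi_surj u.
move: t; apply: free_alg_ind => [|a x y Px Py||i x Px].
- by rewrite quot_pi0.
- by rewrite quot_piD quot_piZ; apply: PD.
- exact: P1.
- by rewrite quot_piM -tensor_in_basis; apply: PM.
Qed.

(** The operators of the basis vectors make [V] a module over the tensor algebra. The tensors that
    act by zero form a two-sided ideal, which contains the relations by the bracket hypothesis, so
    the action descends. *)
Lemma env_action (V : lmodType F) (r : L -> V -> V) :
  (forall v, linear (r^~ v)) -> (forall x, linear (r x)) ->
  (forall x y v, r (bracket x y) v = r x (r y v) - r y (r x v)) ->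
  exists T : U -> V -> V,
  [/\ forall v, linear (T^~ v), forall u, linear (T u), forall v, T 1 v = v,
      forall u w v, T (u * w) v = T u (T w v)
    & forall x v, T (env_in x) v = r x v].
Proof.
move=> rl rr rbr.
have [T [Tl Tr T1 TM Tg]] := free_alg_action (fun i : 'I_(\dim {:L}) => rr b`_i).
have T0 v : T 0 v = 0.
  by have := Tl v (-1) 0 0; rewrite scaler0 addr0 scaleN1r addNr.
have T0r x : T x 0 = 0.
  by have := Tr x (-1) 0 0; rewrite scaler0 addr0 scaleN1r addNr.
have TD x y v : T (x + y) v = T x v + T y v.
  by have := Tl v 1 x y; rewrite !scale1r.
have TB x y v : T (x - y) v = T x v - T y v.
  by have := Tl v (-1) y x; rewrite 2!scaleN1r [- y + x]addrC [- T y v + _]addrC.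
have Tin x v : T (tensor_in x) v = r x v.
  rewrite [in RHS](coord_vbasis (memvf x)) /tensor_in.
  have r0 : r 0 v = 0.
    by have := rl v (-1) 0 0; rewrite scaler0 addr0 scaleN1r addNr.
  elim: (index_enum _) => [|i s IH]; first by rewrite !big_nil T0.
  by rewrite !big_cons Tl rl Tg IH.
have Trel t : ideal_gen (@env_rel _ L) t -> forall v, T t v = 0.
  move=> tI; apply: (tI (fun t => forall v, T t v = 0)) => [|_ [x [y ->]] v];
    last by rewrite !TB !TM !Tin rbr subrr.
  split=> [v|x y Tx Ty v|x y Ty v|x y Tx v]; rewrite ?T0 ?TD ?TM //.
  - by rewrite Tx Ty addr0.
  - by rewrite Ty T0r.
have rep u : {t | u = quot_pi (@env_rel _ L) t} by apply: cid; apply: quot_pi_surj.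
pose R u v := T (sval (rep u)) v.
have RE t v : R (quot_pi (@env_rel _ L) t) v = T t v.
  apply/eqP; rewrite -subr_eq0 -TB /R; case: (rep _) => /= s /quot_piP st.
  by rewrite -opprB -scaleN1r -[_ *: _]addr0 Tl Trel // T0 addr0 scaler0.
exists R; split=> [v a u w|u|v|u w v|x v].
- have [t ->] := quot_pi_surj u; have [s ->] := quot_pi_surj w.
  by rewrite -quot_piZ -quot_piD !RE Tl.
- by have [t ->] := quot_pi_surj u => a v w; rewrite !RE Tr.
- by rewrite RE T1.
- have [t ->] := quot_pi_surj u; have [s ->] := quot_pi_surj w.
  by rewrite -quot_piM !RE TM.
- by rewrite RE Tin.
Qed.

End EnvelopingTheory.

(** * Degrees and homogeneous components of polynomials *)

Section PolynomialDegree.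
Variables (F : fieldType) (n : nat).
Local Notation S := {mpoly F[n]}.

(** [msize] is 0 on the zero polynomial and the total degree plus one otherwise: [msize p <= d]
    bounds the degree strictly, as [flt d] does below. *)
Lemma msize_ind (d : nat) (P : S -> Prop) : lin_closed P ->
  (forall m : 'X_{1..n}, (mdeg m < d)%N -> P 'X_[m]) ->
  forall p, (msize p <= d)%N -> P p.
Proof.
move=> PL PX p pd; rewrite (mpolyE p); apply: lin_closed_sum => // m mp _.
by apply: PX; apply: leq_trans pd; apply: msize_mdeg_lt.
Qed.

Lemma dhomog_ind (d : nat) (P : S -> Prop) : lin_closed P ->
  (forall m : 'X_{1..n}, mdeg m = d -> P 'X_[m]) ->
  forall p, p \is d.-homog -> P p.
Proof.
move=> PL PX p /dhomogP pd; rewrite (mpolyE p); apply: lin_closed_sum => // m mp _.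
by apply: PX; apply: pd.
Qed.

Lemma lin_closed_msize (d : nat) : lin_closed (fun p : S => (msize p <= d)%N).
Proof.
split=> [|a x y xd yd]; first by rewrite msize0.
apply: leq_trans (msizeD_le _ _) _; rewrite geq_max yd andbT.
exact: leq_trans (msizeZ_le _ _) xd.
Qed.

Lemma lin_closed_comp (V W : lmodType F) (K : W -> Prop) (f : V -> W) :
  linear f -> lin_closed K -> lin_closed (fun x => K (f x)).
Proof.
move=> fl [K0 KD]; split=> [|a x y Kx Ky]; last by rewrite fl; apply: KD.
by have := fl (-1) 0 0; rewrite scaler0 addr0 scaleN1r addNr => ->.
Qed.

Lemma mulX_linear (q : S) : linear (fun p : S => q * p).
Proof. by move=> a x y; rewrite mulrDr -scalerAr. Qed.

Lemma msize_mulX i (p : S) d : (msize p <= d)%N -> (msize ('X_i * p) <= d.+1)%N.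
Proof.
apply: (@msize_ind d (fun p => (msize ('X_i * p) <= d.+1)%N)) => [|m md].
  apply: lin_closed_comp (lin_closed_msize _); exact: mulX_linear.
by rewrite -mpolyXD msizeX mdegD mdeg1.
Qed.

Lemma msize_mderiv i (p : S) d : (msize p <= d.+1)%N -> (msize (mderiv i p) <= d)%N.
Proof.
apply: (@msize_ind _ (fun p => (msize (mderiv i p) <= d)%N)) => [|m md].
  by apply: lin_closed_comp (lin_closed_msize _) => a x y; rewrite linearP.
rewrite mderivX; have [->|mi] := eqVneq (m i) 0%N.
  by rewrite scale0r msize0.
apply: leq_trans (msizeZ_le _ _) _; rewrite msizeX.
have Um : (U_(i) <= m)%MM by rewrite lep1mP.
have := mdegD (m - U_(i)) U_(i); rewrite submK // mdeg1; move: md; lia.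
Qed.

Lemma pihomog_msize0 d (p : S) : (msize p <= d)%N -> pihomog mdeg d p = 0.
Proof.
apply: (@msize_ind _ (fun p => pihomog mdeg d p = 0)) => [|m md].
  by split=> [|a x y xd yd]; rewrite ?linear0 // linearP /= xd yd scaler0 addr0.
by rewrite pihomogX; case: eqP md => // ->; rewrite ltnn.
Qed.

Lemma pihomog_mulX d i (p : S) :
  pihomog mdeg d.+1 ('X_i * p) = 'X_i * pihomog mdeg d p.
Proof.
elim/mpolyind: p => [|c m p _ _ IH]; first by rewrite mulr0 !linear0 mulr0.
rewrite mulrDr -scalerAr !linearP /= IH mulrDr -scalerAr; congr (_ *: _ + _).
rewrite -mpolyXD !pihomogX /= mdegD mdeg1 eqSS.
by case: eqP => _; rewrite ?mulr0 ?mpolyXD.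
Qed.

Lemma pihomog0_mulX i (p : S) : pihomog mdeg 0 ('X_i * p) = 0.
Proof.
elim/mpolyind: p => [|c m p _ _ IH]; first by rewrite mulr0 linear0.
rewrite mulrDr -scalerAr linearP /= IH addr0 -mpolyXD pihomogX /=.
by rewrite mdegD mdeg1 scaler0.
Qed.

(** This induction suits operators that are known only through their value at 1 and their
    commutators with multiplications. *)
Lemma mpoly_mul_ind (P : S -> Prop) : lin_closed P ->
  P 1 -> (forall i p, P p -> P ('X_i * p)) -> forall p, P p.
Proof.
move=> [P0 PD] P1 PM; elim/mpolyind => // c m p _ _ Pp; apply: PD => //.
rewrite mpolyXE_id; move: (index_enum _) => s.
elim: s => [|i s IH]; first by rewrite big_nil.
rewrite big_cons; elim: (m i) => [|j IHj]; first by rewrite expr0 mul1r.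
by rewrite exprS -mulrA; apply: PM.
Qed.

(** [m2s] lists the variables of a monomial in a fixed order, so a further factor ['X_i] need not
    end up at the front. *)
Lemma perm_m2sU i (m : 'X_{1..n}) : perm_eq (m2s (U_(i) + m)%MM) (i :: m2s m).
Proof.
have cE (l : 'X_{1..n}) j : count_mem j (m2s l) = l j.
  by have /mnmP/(_ j) := s2mK l; rewrite /s2m mnmE.
apply/allP => j _ /=; rewrite !cE mnmDE mnm1E; exact: eqxx.
Qed.

End PolynomialDegree.

(** * Filtration and symbols *)

Section Filtration.
Variables (F : fieldType) (L : lieAlgType F).
Local Notation n := (\dim {:L}).
Local Notation b := (vbasis {:L}).
Local Notation S := {mpoly F[n]}.
Local Notation U := (env_alg L).

Lemma sym_in_basis (i : 'I_n) : sym_in b`_i = 'X_i.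
Proof.
rewrite /sym_in (bigD1 i) //= big1 => [|j ji].
  by rewrite coord_free ?(basis_free (vbasisP _)) // eqxx scale1r addr0.
by rewrite coord_free ?(basis_free (vbasisP _)) // eq_sym (negbTE ji) scale0r.
Qed.

Lemma msize_mul_sym_in (x : L) (p : S) d :
  (msize p <= d)%N -> (msize (sym_in x * p) <= d.+1)%N.
Proof.
move=> pd; rewrite /sym_in mulr_suml.
apply: (big_ind (fun q : S => (msize q <= d.+1)%N)) => [|q r qd rd|i _].
- by rewrite msize0.
- by apply: leq_trans (msizeD_le _ _) _; rewrite geq_max qd.
- by rewrite -scalerAl; apply: leq_trans (msizeZ_le _ _) _; apply: msize_mulX.
Qed.

(* The bound [d] is strict: [u] is a combination of products of fewer than [d]
   elements of [L]. *)
Inductive flt : nat -> U -> Prop :=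
| flt_0 d : flt d 0
| flt_1 d : flt d.+1 1
| flt_lin d (a : F) u v : flt d u -> flt d v -> flt d (a *: u + v)
| flt_mul d (x : L) u : flt d u -> flt d.+1 (env_in x * u).

Lemma flt_closed d : lin_closed (flt d).
Proof. by split; [exact: flt_0 | exact: flt_lin]. Qed.

Lemma flt_add d u v : flt d u -> flt d v -> flt d (u + v).
Proof. by move=> du dv; rewrite -[u]scale1r; apply: flt_lin. Qed.

Lemma flt_0P u : flt 0 u -> u = 0.
Proof.
move e0: 0%N => e du; elim: du e0 => {e u} // d a u v _ IHu _ IHv d0.
by rewrite IHu // IHv // scaler0 addr0.
Qed.

Lemma flt_mono d e u : (d <= e)%N -> flt d u -> flt e u.
Proof.
move=> de du; elim: du e de => {d u} [d|d|d a u v _ IHu _ IHv|d x u _ IHu] e de.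
- exact: flt_0.
- by case: e de => // e _; exact: flt_1.
- by apply: flt_lin; [apply: IHu | apply: IHv].
- by case: e de => // e de; apply: flt_mul; apply: IHu.
Qed.

Lemma flt_total u : exists d, flt d u.
Proof.
elim/env_ind: u => [|a u v [d du] [e ev]||x u [d du]].
- by exists 0%N; exact: flt_0.
- exists (maxn d e); apply: flt_lin.
    by apply: flt_mono du; rewrite leq_maxl.
  by apply: flt_mono ev; rewrite leq_maxr.
- by exists 1%N; exact: flt_1.
- by exists d.+1; exact: flt_mul.
Qed.

Definition env_ad (x : L) (u : U) : U := env_in x * u - u * env_in x.

Lemma env_ad_linear x a u v : env_ad x (a *: u + v) = a *: env_ad x u + env_ad x v.
Proof.
rewrite /env_ad mulrDr mulrDl -scalerAr -scalerAl scalerBr opprD.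
by rewrite addrACA.
Qed.

Lemma env_ad_mul x y u :
  env_ad x (env_in y * u) = env_in (bracket x y) * u + env_in y * env_ad x u.
Proof. by rewrite /env_ad env_in_bracket mulrBl mulrBr !mulrA addrA subrK. Qed.

Lemma env_ad1 x : env_ad x 1 = 0.
Proof. by rewrite /env_ad mulr1 mul1r subrr. Qed.

Lemma flt_ad d x u : flt d u -> flt d (env_ad x u).
Proof.
elim=> {d u} [d|d|d a u v _ IHu _ IHv|d y u du IHu].
- by rewrite /env_ad mulr0 mul0r subrr; exact: flt_0.
- by rewrite env_ad1; exact: flt_0.
- by rewrite env_ad_linear; exact: flt_lin.
- by rewrite env_ad_mul; apply: flt_add; apply: flt_mul.
Qed.

(* The symbol is a relation: that an element of degree at most [d] has only one
   symbol of degree [d] is the hard half of the PBW theorem, which is not used. *)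
Inductive symbol : nat -> U -> S -> Prop :=
| symbol_1 : symbol 0 1 1
| symbol_lin d (a : F) u v p q : symbol d u p -> symbol d v q ->
    symbol d (a *: u + v) (a *: p + q)
| symbol_mul d (x : L) u p : symbol d u p -> symbol d.+1 (env_in x * u) (sym_in x * p)
| symbol_low d u : flt d u -> symbol d u 0.

Lemma symbol_add d u v p q : symbol d u p -> symbol d v q -> symbol d (u + v) (p + q).
Proof. by move=> du dv; rewrite -[u]scale1r -[p]scale1r; apply: symbol_lin. Qed.

(** Both actions are derivations and they agree on L. This equivariance is what lifts the submodule
    generated by e^(k+1) to the enveloping algebra. *)
Lemma symbol_ad d x u p : symbol d u p -> symbol d (env_ad x u) (sym_act x p).
Proof.
have act0 : sym_act x (0 : S) = 0.
  by have := sym_act_linear x (-1) 0 0; rewrite scaler0 addr0 scaleN1r addNr.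
elim=> {d u p} [|d a u v p q _ IHu _ IHv|d y u p du IHu|d u du].
- have -> : sym_act x (1 : S) = 0.
    by rewrite /sym_act big1 // => i _; rewrite mderivC mulr0.
  by rewrite env_ad1; apply: symbol_low; exact: flt_0.
- by rewrite env_ad_linear sym_act_linear; apply: symbol_lin.
- rewrite env_ad_mul sym_actM sym_act_in.
  by apply: symbol_add; apply: symbol_mul.
- by rewrite act0; apply: symbol_low; apply: flt_ad.
Qed.

Lemma dhomog_sym_in (x : L) : sym_in x \is 1.-homog.
Proof.
rewrite /sym_in; apply: rpred_sum => i _; apply: rpredZ.
by rewrite dhomogX /= mdeg1.
Qed.

Lemma symbol_dhomog d u p : symbol d u p -> p \is d.-homog.
Proof.
elim=> {d u p} [|d a u v p q _ IHu _ IHv|d y u p du IHu|d u du].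
- exact: dhomog1.
- by apply: rpredD => //; apply: rpredZ.
- by rewrite -add1n; apply: dhomogM => //; apply: dhomog_sym_in.
- exact: rpred0.
Qed.

Lemma symbol_exists d u : flt d.+1 u -> exists p, symbol d u p.
Proof.
move eqe: d.+1 => e fu.
elim: fu d eqe => {e u} [e|e|e a u v _ IHu _ IHv|e x u fu IHu] d.
- by move=> _; exists 0; apply: symbol_low; exact: flt_0.
- case: d => [|d] _; first by exists 1; exact: symbol_1.
  by exists 0; apply: symbol_low; exact: flt_1.
- move=> /[dup] /IHu [p up] /IHv [q vq]; exists (a *: p + q); exact: symbol_lin.
- case: d => [|d] [ed].
    rewrite -ed in fu; exists 0; rewrite (flt_0P fu) mulr0.
    by apply: symbol_low; exact: flt_0.
  by have [p up] := IHu d ed; exists (sym_in x * p); exact: symbol_mul.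
Qed.

Definition word (s : seq 'I_n) : U := \prod_(i <- s) env_in b`_i.

Lemma word_cons i s : word (i :: s) = env_in b`_i * word s.
Proof. by rewrite /word big_cons. Qed.

Lemma flt_word s : flt (size s).+1 (word s).
Proof.
elim: s => [|i s IH]; first by rewrite /word big_nil; exact: flt_1.
by rewrite word_cons; apply: flt_mul.
Qed.

(** The letter [i] moves past [s] one letter at a time; each exchange costs a product in which two
    factors are replaced by their bracket. *)
Lemma flt_word_move i s t :
  flt (size s + size t).+1 (word (i :: s ++ t) - word (s ++ i :: t)).
Proof.
elim: s => [|j s IH] /=; first by rewrite subrr; exact: flt_0.
rewrite !word_cons -[X in X - _](subrK (env_in b`_j * (env_in b`_i * word (s ++ t)))).
rewrite -addrA -mulrBr; apply: flt_add; last first.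
  by apply: flt_mul; rewrite -word_cons.
rewrite !mulrA -mulrBl -env_in_bracket addSn -size_cat.
exact/flt_mul/flt_word.
Qed.

(** The associated graded algebra of U(L) is commutative: the easy half of the PBW theorem. *)
Lemma flt_word_perm s t : perm_eq s t -> flt (size s) (word s - word t).
Proof.
elim: s t => [|i s IH] t.
  by rewrite perm_sym => /perm_nilP ->; rewrite subrr; exact: flt_0.
move=> st; have: i \in t by rewrite -(perm_mem st) mem_head.
move=> /[dup] /splitPr it _; case: it st => t1 t2.
rewrite perm_sym perm_catC /= perm_cons perm_catC perm_sym => st.
rewrite -[word (i :: s)](subrK (word (i :: t1 ++ t2))) -addrA /=.
apply: flt_add; last first.
  by rewrite (perm_size st) size_cat; exact: flt_word_move.
by rewrite !word_cons -mulrBr; apply: flt_mul; exact: IH.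
Qed.

(* The lift of a form of degree [d]; only its value modulo [flt d] matters. *)
Definition sym_lift d (p : S) : U :=
  \sum_(m : 'X_{1..n < d.+1}) p@_m *: word (m2s m).

Lemma sym_lift_linear d : linear (sym_lift d).
Proof.
move=> a p q; rewrite /sym_lift scaler_sumr -big_split; apply: eq_bigr => m _ /=.
by rewrite linearP /= scalerDl scalerA.
Qed.

Lemma sym_liftX d (m : 'X_{1..n}) : mdeg m = d -> sym_lift d 'X_[m] = word (m2s m).
Proof.
move=> md; have md1 : (mdeg m < d.+1)%N by rewrite md.
rewrite /sym_lift (bigD1 (BMultinom md1)) //= mcoeffX eqxx scale1r big1 ?addr0 //.
move=> l lm; rewrite mcoeffX; case: eqP => [ml|_]; last by rewrite scale0r.
by case/eqP: lm; apply/val_inj.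
Qed.

(** By linearity [x] is a basis vector and [p] a monomial. The two products then differ only in the
    order of their factors. *)
Lemma flt_sym_lift_mul d (x : L) p : p \is d.-homog ->
  flt d.+1 (env_in x * sym_lift d p - sym_lift d.+1 (sym_in x * p)).
Proof.
move=> pd; rewrite [x](coord_vbasis (memvf x)).
set s := index_enum _; elim: s => [|i s IH].
  rewrite big_nil (lin0 (@env_in_linear F L)) (lin0 (@sym_in_linear F L)).
  by rewrite !mul0r (lin0 (@sym_lift_linear _)) subrr; exact: flt_0.
rewrite big_cons env_in_linear sym_in_linear !mulrDl -scalerAl -scalerAl.
rewrite sym_lift_linear opprD addrACA -scalerBr; apply: flt_lin => // {s IH}.
rewrite sym_in_basis; move: p pd; apply: dhomog_ind => [|m md].
  apply: (@lin_closed_comp _ _ _ (flt d.+1)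
    (fun p => env_in b`_i * sym_lift d p - sym_lift d.+1 ('X_i * p))); last first.
    exact: flt_closed.
  move=> a p q; rewrite mulrDr -scalerAr !sym_lift_linear mulrDr -scalerAr.
  by rewrite opprD addrACA scalerBr.
rewrite -mpolyXD !sym_liftX ?mdegD ?mdeg1 ?md //.
rewrite -word_cons -md -(size_m2s m); apply: (@flt_word_perm (i :: m2s m)).
by rewrite perm_sym; exact: perm_m2sU.
Qed.

(** A symbol determines the element modulo lower degree. In particular an element with symbol 0 in
    degree [d] lies in [flt d]. *)
Lemma symbol_flt d u p : symbol d u p -> flt d (u - sym_lift d p).
Proof.
elim=> {d u p} [|d a u v p q _ IHu _ IHv|d y u p du IHu|d u du].
- rewrite -mpolyX0 sym_liftX ?mdeg0 //.
  have /size0nil -> : size (m2s (0%MM : 'X_{1..n})) = 0%N by rewrite size_m2s mdeg0.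
  by rewrite /word big_nil subrr; exact: flt_0.
- by rewrite sym_lift_linear opprD addrACA -scalerBr; exact: flt_lin.
- rewrite -[env_in y * u](subrK (env_in y * sym_lift d p)) -addrA.
  apply: flt_add; last by apply: flt_sym_lift_mul; apply: symbol_dhomog du.
  by rewrite -mulrBr; apply: flt_mul.
- by rewrite (lin0 (@sym_lift_linear _)) subr0.
Qed.

End Filtration.

(** * Deformations of the multiplication action *)

Section Deformation.
Variables (F : fieldType) (L : lieAlgType F) (e : L) (k : nat).
Local Notation n := (\dim {:L}).
Local Notation b := (vbasis {:L}).
Local Notation S := {mpoly F[n]}.
Local Notation U := (env_alg L).
Local Notation W := (submodule_gen (sym_in e ^+ k.+1)).
Local Notation J := (ideal_gen W).
Local Notation I := (ideal_gen (fun u : U => u = env_in e ^+ k.+1)).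

Lemma ideal_lin_closed (A : algType F) (K : A -> Prop) :
  two_sided_ideal K -> lin_closed K.
Proof.
case=> K0 KD KM _; split=> // a x y Kx Ky; apply: KD => //.
by rewrite -[x]mul1r scalerAl; apply: KM.
Qed.

Lemma submodule_gen_self (v : S) : submodule_gen v v.
Proof. by move=> V _. Qed.

Lemma submodule_gen_submodule (v : S) : is_submodule (submodule_gen v).
Proof.
split=> [V [] //|a p q vp vq V VV Vv|x p vp V VV Vv].
- by case: (VV) => _ VD _; apply: VD; [apply: vp | apply: vq].
- by case: (VV) => _ _ VA; apply: VA; apply: vp.
Qed.

Lemma symbol_gen d : symbol d (env_in e ^+ d) (sym_in e ^+ d).
Proof.
elim: d => [|d IH]; first by rewrite !expr0; exact: symbol_1.
by rewrite !exprS; apply: symbol_mul.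
Qed.

(** The symbols of degree k+1 of elements of the two-sided ideal form an L-submodule, because the
    ideal is stable under [env_ad]; it contains e^(k+1). *)
Lemma submodule_lift w : W w -> exists2 u, I u & symbol k.+1 u w.
Proof.
have [I0 ID IMl IMr] := ideal_gen_ideal (fun u : U => u = env_in e ^+ k.+1).
have [_ IL] := ideal_lin_closed (ideal_gen_ideal (fun u : U => u = env_in e ^+ k.+1)).
move=> Ww; apply: (Ww (fun w => exists2 u, I u & symbol k.+1 u w)); last first.
  by exists (env_in e ^+ k.+1); [apply: ideal_gen_sub | apply: symbol_gen].
split=> [|a p q [u Iu up] [v Iv vq]|x p [u Iu up]].
- by exists 0 => //; apply: symbol_low; exact: flt_0.
- by exists (a *: u + v); [apply: IL | apply: symbol_lin].
- exists (env_ad x u); last exact: symbol_ad.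
  apply: ID; first exact: IMl.
  by rewrite -mulN1r; apply: IMl; apply: IMr.
Qed.

Lemma ideal_lift p : J p -> forall d, J (pihomog mdeg d p) /\
  exists2 u, I u & symbol d u (pihomog mdeg d p).
Proof.
have JI := ideal_gen_ideal W.
have [J0 JL] := ideal_lin_closed JI.
have II := ideal_gen_ideal (fun u : U => u = env_in e ^+ k.+1).
have [I0 IL] := ideal_lin_closed II.
pose K p := forall d, J (pihomog mdeg d p) /\
  exists2 u, I u & symbol d u (pihomog mdeg d p).
have KL : lin_closed K.
  split=> [d|a x y Kx Ky d].
    by rewrite linear0; split=> //; exists 0 => //; apply: symbol_low; exact: flt_0.
  have [Jx [u Iu ux]] := Kx d; have [Jy [v Iv vy]] := Ky d.
  rewrite linearP /=; split; first exact: JL.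
  by exists (a *: u + v); [apply: IL | apply: symbol_lin].
have KMl x y : K y -> K (x * y).
  move=> Ky; apply: (@mpoly_mul_ind _ _ (fun x => K (x * y))) => [||i {}x Kx d].
  - by apply: lin_closed_comp KL => a u v; rewrite mulrDl -scalerAl.
  - by rewrite mul1r.
  rewrite -mulrA; case: d => [|d].
    rewrite pihomog0_mulX; split=> //.
    by exists 0 => //; apply: symbol_low; exact: flt_0.
  have [Jx [u Iu ux]] := Kx d; rewrite pihomog_mulX; split.
    by case: JI => _ _ JM _; apply: JM.
  rewrite -(sym_in_basis i); exists (env_in b`_i * u); last exact: symbol_mul.
  by case: II => _ _ IM _; apply: IM.
apply: (_ : forall p, J p -> K p) => {}p Jp; apply: (Jp K) => [|w Ww d].
  case: (KL) => K0 KD; split=> // [x y Kx Ky|x y Kx]; last first.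
    by rewrite mulrC; apply: KMl.
  by rewrite -[x]scale1r; apply: KD.
have [u Iu uw] := submodule_lift Ww.
have wd := symbol_dhomog uw.
have [<-|dk] := eqVneq k.+1 d.
  by rewrite pihomog_dE //; split; [apply: ideal_gen_sub | exists u].
rewrite (pihomog_ne0 dk wd); split=> //.
by exists 0 => //; apply: symbol_low; exact: flt_0.
Qed.

(** * Comparison of the two algebras through a deformed action on S(L) *)

Variable D : L -> S -> S.
Hypothesis D_linearl : forall p, linear (D^~ p).
Hypothesis D_linearr : forall x, linear (D x).
Hypothesis D_msize : forall x p d, (msize p <= d)%N -> (msize (D x p) <= d)%N.

Definition deformed_act (x : L) (p : S) : S := sym_in x * p + D x p.
Local Notation r := deformed_act.

Hypothesis r_bracket : forall x y p, r (bracket x y) p = r x (r y p) - r y (r x p).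
Hypothesis r_ideal : forall x p, J p -> J (r x p).
Hypothesis r_gen : forall p, J (iter k.+1 (r e) p).

Lemma deformed_act_linearl p : linear (r^~ p).
Proof.
move=> a x y; rewrite /r sym_in_linear D_linearl mulrDl -scalerAl scalerDr.
by rewrite addrACA.
Qed.

Lemma deformed_act_linearr x : linear (r x).
Proof.
move=> a p q; rewrite /r D_linearr mulrDr -scalerAr scalerDr.
by rewrite addrACA.
Qed.

Theorem same_dim_of_deformation : same_dim (c2_alg e k) (zhu_alg e k).
Proof.
have [T [Tl Tr T1 TM Tin]] :=
  env_action deformed_act_linearl deformed_act_linearr r_bracket.
have [J0 JD JMl JMr] := ideal_gen_ideal W.
have [_ JL] := ideal_lin_closed (ideal_gen_ideal W).
pose Phi u := T u 1.
have Phi_mul x u : Phi (env_in x * u) = r x (Phi u) by rewrite /Phi TM Tin.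
have Phi_msize d u : flt d u -> (msize (Phi u) <= d)%N.
  elim=> {d u} [d|d|d a u v _ IHu _ IHv|d x u _ IHu].
  - by rewrite /Phi (lin0 (Tl 1)) msize0.
  - by rewrite /Phi T1 msize1.
  - by rewrite /Phi Tl; apply: (lin_closed_msize F n d).2.
  - rewrite Phi_mul /r; apply: leq_trans (msizeD_le _ _) _; rewrite geq_max.
    apply/andP; split; first exact: msize_mul_sym_in.
    by apply: D_msize; apply: ltnW.
(* The component of degree [d] of [Phi u] is the symbol of [u], since [D] does not raise degrees. *)
have Phi_sym d u p : symbol d u p ->
    (msize (Phi u - p) <= d)%N /\ (msize (Phi u) <= d.+1)%N.
  elim=> {d u p} [|d a u v p q _ [IHu IHu'] _ [IHv IHv']|d x u p du [IHu IHu']|d u du].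
  - by rewrite /Phi T1 subrr msize0 msize1.
  - rewrite /Phi Tl opprD addrACA -scalerBr.
    by split; apply: (lin_closed_msize F n _).2.
  - rewrite Phi_mul /r addrAC -mulrBr.
    have h1 : (msize (sym_in x * (Phi u - p)) <= d.+1)%N by apply: msize_mul_sym_in.
    have h2 : (msize (D x (Phi u)) <= d.+1)%N by apply: D_msize.
    have h3 : (msize (sym_in x * Phi u) <= d.+2)%N by apply: msize_mul_sym_in.
    split; apply: leq_trans (msizeD_le _ _) _; rewrite geq_max ?h1 //.
    by rewrite h3 ltnW.
  - by rewrite subr0; split; [|apply: ltnW]; apply: Phi_msize.
have T_ideal u p : J p -> J (T u p).
  elim/env_ind: u p => [|a u v IHu IHv|//|x u IHu] p Jp.
  - by rewrite (lin0 (Tl p)).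
  - by rewrite Tl; apply: JL; [apply: IHu | apply: IHv].
  - by rewrite T1.
  - by rewrite TM Tin; apply: r_ideal; apply: IHu.
(* Quantifying over [p] instead of taking p = 1 gives stability under right multiplication;
   stability under left multiplication is [T_ideal]. *)
have T_I u : I u -> forall p, J (T u p).
  move=> Iu; apply: (Iu (fun u => forall p, J (T u p))) => [|_ -> p].
    split=> [p|x y Ix Iy p|x y Iy p|x y Ix p].
    - by rewrite (lin0 (Tl p)).
    - by have := Tl p 1 x y; rewrite !scale1r => ->; apply: JD.
    - by rewrite TM; apply: T_ideal.
    - by rewrite TM; apply: Ix.
  have -> : T (env_in e ^+ k.+1) p = iter k.+1 (r e) p => //.
  by elim: k.+1 => [|d IH]; rewrite ?expr0 ?T1 // exprS TM Tin IH.
(* Induction on the degree: the symbol of [u] is a component of [Phi u], hence the symbol of some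
   [v] in I. Then [u - v] has lower degree and [Phi (u - v)] is still in J. *)
have Phi_J d u : flt d u -> J (Phi u) -> I u.
  have [I0 ID IMl IMr] := ideal_gen_ideal (fun u : U => u = env_in e ^+ k.+1).
  elim: d u => [|d IH] u du JPhi; first by rewrite (flt_0P du).
  have [p up] := symbol_exists du; have [Phiup _] := Phi_sym _ _ _ up.
  have [_ [v Iv]] := ideal_lift JPhi d.
  have -> : pihomog mdeg d (Phi u) = p.
    rewrite -[Phi u](subrK p) linearD /= (pihomog_msize0 Phiup) add0r.
    exact/pihomog_dE/(symbol_dhomog up).
  move=> vp; rewrite -[u](subrK v); apply: ID => //; apply: IH.
    have := symbol_flt (symbol_lin (-1) vp up).
    rewrite !scaleN1r addNr (lin0 (@sym_lift_linear _ _ _)) subr0 addrC.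
    by [].
  have := Tl 1 (-1) v u; rewrite !scaleN1r ![- _ + _]addrC => PhiB.
  rewrite /Phi PhiB; apply: JD => //.
  by rewrite -mulN1r; apply: JMl; apply: T_I.
have Phi_surj d p : (msize p <= d)%N -> exists u, Phi u = p.
  have surjL : lin_closed (fun p => exists u, Phi u = p).
    split=> [|a x y [u <-] [v <-]]; first by exists 0; rewrite /Phi (lin0 (Tl 1)).
    by exists (a *: u + v); rewrite /Phi Tl.
  elim: d p => [|d IH].
    by apply: (@msize_ind _ _ _ (fun p => exists u, Phi u = p)).
  apply: (@msize_ind _ _ _ (fun p => exists u, Phi u = p)) => // m md.
  case: (pickP (fun i => m i != 0%N)) => [i mi|m0]; last first.
    exists 1; rewrite /Phi T1; suff -> : m = 0%MM by rewrite mpolyX0.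
    by apply/mnmP => i; rewrite mnm0E; have /negbFE/eqP := m0 i.
  have Um : (U_(i) <= m)%MM by rewrite lep1mP.
  have m'd : (msize 'X_[F, (m - U_(i))%MM] <= d)%N.
    have := mdegD (m - U_(i)) U_(i).
    by rewrite submK // mdeg1 msizeX; move: md; lia.
  have [u uX] := IH _ m'd; have [v vX] := IH _ (D_msize b`_i m'd).
  (* The operator of [b]_i[sends X^(m-i) to X^m plus]D b[_i] of X^(m-i). Both this last term and
     X^(m-i) have preimages by induction. *)
  exists (-1 *: v + env_in b`_i * u); have := Phi_mul b`_i u; rewrite /Phi Tl => ->.
  rewrite -/(Phi u) -/(Phi v) uX vX /r addrCA scaleN1r addNr addr0 sym_in_basis.
  by rewrite -mpolyXD addmC submK.
pose f u : c2_alg e k := quot_pi W (Phi u).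
pose g u : zhu_alg e k := quot_pi (fun u : U => u = env_in e ^+ k.+1) u.
(* The monomials are countable, so their classes form a sequence; numbers that encode no monomial
   give 0. *)
pose v j : c2_alg e k := quot_pi W
  (if choice.unpickle j is Some m then 'X_[(m : 'X_{1..n})] else 0).
apply: (@same_dim_of_surjections _ _ _ _ f g v).
- by move=> a x y; rewrite /f /Phi Tl quot_piD quot_piZ.
- by move=> a x y; rewrite /g quot_piD quot_piZ.
- move=> y; have [p ->] := quot_pi_surj y.
  by have [u <-] := Phi_surj _ _ (leqnn (msize p)); exists u.
- exact: quot_pi_surj.
- move=> u; rewrite /f /g -(quot_pi0 W) -(quot_pi0 (fun u : U => u = env_in e ^+ k.+1)).
  rewrite !quot_piP !subr0; split=> [|Iu]; last exact: T_I.
  by have [d du] := flt_total u; apply: Phi_J du.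
move=> K [K0 KD] Kv w; have [p ->] := quot_pi_surj w.
elim/mpolyind: p => [|c m p _ _ IH]; first by rewrite quot_pi0.
rewrite quot_piD quot_piZ; apply: KD => //.
by have := Kv (choice.pickle m); rewrite /v choice.pickleK.
Qed.

End Deformation.

(** * The induced module *)

(** The commutator computed in [half_defect_bracket], with every vector made an atom: [h] is 1/2,
    [B] is the bracket of x and y, [gxy] is gl x (gl y p), [DyGx] is dop y (gl x p), [gm] is gl (y
    x) p, and [s] is the value of the character at x y. *)
Lemma half_bracket_identity (F : fieldType) (T : comAlgType F) (h s : F)
    (X Y B p gx gy gxy gyx gm Dx Dy DB DyGx DxGy DD : T) : h + h = 1 ->
  B * p + (h *: (gxy - gyx) + (h * h) *: DB) =
  X * (Y * p + (h *: gy + (h * h) *: Dy)) +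
  (h *: (B * p + Y * gx + (h *: gxy + (h * h) *: (DyGx + DB))) +
   (h * h) *: (Y * Dx + (gm + (gxy - gyx) + s *: p) +
               (h *: DxGy + (h * h) *: DD))) -
  (Y * (X * p + (h *: gx + (h * h) *: Dx)) +
   (h *: (- B * p + X * gy + (h *: gyx + (h * h) *: (DxGy - DB))) +
    (h * h) *: (X * Dy + (gm + s *: p) + (h *: DyGx + (h * h) *: DD)))).
Proof.
(* Scalars become elements of [T], so that [ring] applies; the relation H + H = 1 is used by
   multiplying the left side by it. *)
have ZE (a : F) : exists A : T, forall u, a *: u = A * u.
  by exists a%:A => u; rewrite mulr_algl.
move=> h2; have [H hE] := ZE h; have [K sE] := ZE s.
have E : H + H = 1 by rewrite -[H]mulr1 -hE -scalerDl h2 scale1r.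
have hhE (u : T) : (h * h) *: u = H * (H * u) by rewrite -!hE scalerA.
rewrite !hhE !hE !sE -[LHS]mul1r -E; ring.
Qed.

(** * Skew elements of an anti-involution, and the action of gl(V) on their symmetric algebra *)

Section Operators.
Variables (F : numFieldType) (N : nat) (L : lieAlgType F).
Variables (mx : L -> 'M[F]_N) (lift : 'M[F]_N -> L) (adj : 'M[F]_N -> 'M[F]_N).
Hypothesis mx_linear : linear mx.
Hypothesis mx_inj : injective mx.
Hypothesis mx_bracket : forall x y, mx (bracket x y) = mx x *m mx y - mx y *m mx x.
Hypothesis adj_linear : linear adj.
Hypothesis adjM : forall P Q, adj (P *m Q) = adj Q *m adj P.
Hypothesis adjK : forall P, adj (adj P) = P.
Hypothesis tr_adj : forall P, \tr (adj P) = \tr P.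
Hypothesis adj_mx : forall x, adj (mx x) = - mx x.
Hypothesis mx_lift : forall P, adj P = - P -> mx (lift P) = P.

Local Notation n := (\dim {:L}).
Local Notation b := (vbasis {:L}).
Local Notation S := {mpoly F[n]}.

(* The action of gl(V) on the nilradical, identified with L = sp(V). *)
Definition gl_act (P : 'M[F]_N) (x : L) : L := lift (- (adj P *m mx x + mx x *m P)).

Lemma mx_gl_act P x : mx (gl_act P x) = - (adj P *m mx x + mx x *m P).
Proof.
apply: mx_lift; rewrite (linN adj_linear) (linD adj_linear) !adjM !adj_mx adjK.
by rewrite mulNmx mulmxN opprK -opprD opprK addrC.
Qed.

Lemma gl_act_linearl x : linear (gl_act^~ x).
Proof.
move=> a P Q; apply: mx_inj; rewrite mx_linear !mx_gl_act adj_linear.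
rewrite mulmxDl mulmxDr -scalemxAl -scalemxAr addrACA -scalerDr opprD.
by rewrite -scalerN.
Qed.

Lemma gl_act_linearr P : linear (gl_act P).
Proof.
move=> a x y; apply: mx_inj; rewrite mx_linear !mx_gl_act mx_linear.
rewrite mulmxDl mulmxDr -scalemxAl -scalemxAr addrACA -scalerDr opprD.
by rewrite -scalerN.
Qed.

Lemma gl_act_mx x y : gl_act (mx x) y = bracket x y.
Proof.
by apply: mx_inj; rewrite mx_gl_act mx_bracket adj_mx mulNmx opprD opprK.
Qed.

Lemma gl_act_comm P Q x :
  gl_act (P *m Q - Q *m P) x = gl_act P (gl_act Q x) - gl_act Q (gl_act P x).
Proof.
apply: mx_inj.
rewrite (linB mx_linear) !mx_gl_act (linB adj_linear) !adjM.
rewrite !mulmxN !mulNmx !mulmxDl !mulmxDr.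
rewrite !mulNmx !mulmxN !mulmxA; apply/matrixP => i j; rewrite !mxE; ring.
Qed.

(** Up to sign both sides are the triple product x a y + y a x, symmetric in x and y. *)
Lemma gl_act_mulC a x y : gl_act (mx a *m mx x) y = gl_act (mx a *m mx y) x.
Proof.
apply: mx_inj; rewrite !mx_gl_act !adjM !adj_mx !(mulNmx, mulmxN, opprK).
by rewrite !mulmxA addrC.
Qed.

Definition gl (P : 'M[F]_N) (p : S) : S :=
  \sum_(i < n) sym_in (gl_act P b`_i) * mderiv i p.

Lemma gl_linearr P : linear (gl P).
Proof.
move=> a p q; rewrite /gl scaler_sumr -big_split; apply: eq_bigr => i _ /=.
by rewrite linearP mulrDr -scalerAr.
Qed.

Lemma gl_linearl p : linear (gl^~ p).
Proof.
move=> a P Q; rewrite /gl scaler_sumr -big_split; apply: eq_bigr => i _ /=.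
by rewrite gl_act_linearl sym_in_linear mulrDl -scalerAl.
Qed.

Lemma gl_sym_act x p : gl (mx x) p = sym_act x p.
Proof. by rewrite /gl /sym_act; apply: eq_bigr => i _; rewrite gl_act_mx. Qed.

Lemma gl1 P : gl P 1 = 0.
Proof. by rewrite /gl big1 // => i _; rewrite mderivC mulr0. Qed.

Lemma glM P p q : gl P (p * q) = gl P p * q + p * gl P q.
Proof.
rewrite /gl mulr_suml mulr_sumr -big_split; apply: eq_bigr => i _ /=.
by rewrite mderivM mulrDr -mulrA (mulrCA _ p).
Qed.

Lemma mderiv_sym_in i x : mderiv i (sym_in x) = (coord b i x)%:MP.
Proof.
rewrite /sym_in linear_sum (bigD1 i) //= linearZ /= big1 => [|j ji].
  rewrite addr0 mderivX mnm1E eqxx scale1r -[X in (X - _)%MM]add0m addmK mpolyX0.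
  by rewrite -mul_mpolyC mulr1.
by rewrite linearZ /= mderivX mnm1E (negbTE ji) scale0r scaler0.
Qed.

Lemma linear_coord (V : lmodType F) (f : L -> V) x :
  linear f -> f x = \sum_(i < n) coord b i x *: f b`_i.
Proof.
move=> fl; rewrite {1}(coord_vbasis (memvf x)).
set s := index_enum _; elim: s => [|i s IH]; first by rewrite !big_nil lin0.
by rewrite !big_cons fl IH.
Qed.

Lemma gl_sym_in P x : gl P (sym_in x) = sym_in (gl_act P x).
Proof.
rewrite (@linear_coord _ (fun x => sym_in (gl_act P x))) => [|a y z]; last first.
  by rewrite gl_act_linearr sym_in_linear.
by rewrite /gl; apply: eq_bigr => i _; rewrite mderiv_sym_in mulrC mul_mpolyC.
Qed.

Lemma gl_mul P x p :
  gl P (sym_in x * p) = sym_in (gl_act P x) * p + sym_in x * gl P p.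
Proof. by rewrite glM gl_sym_in. Qed.

(** The operator identities below are checked at 1 and then carried along multiplications by
    elements of L, using commutators only. *)
Lemma operator_ext (f g : S -> S) : linear f -> linear g -> f 1 = g 1 ->
  (forall x p, f p = g p -> f (sym_in x * p) = g (sym_in x * p)) -> f =1 g.
Proof.
move=> fl gl fg1 fgM; apply: mpoly_mul_ind => // [|i p].
  by split=> [|a p q pE qE]; [rewrite !lin0 | rewrite fl gl pE qE].
by rewrite -sym_in_basis; apply: fgM.
Qed.

Lemma gl_comm P Q p : gl (P *m Q - Q *m P) p = gl P (gl Q p) - gl Q (gl P p).
Proof.
have ringE (T : comNzRingType) (u v w z x q r1 r2 s t : T) :
    (u - v) * q + x * (s - t) =
    u * q + z * r1 + (w * r2 + x * s) - (v * q + w * r2 + (z * r1 + x * t)).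
  by ring.
apply: (operator_ext (f := gl (P *m Q - Q *m P))
  (g := fun p => gl P (gl Q p) - gl Q (gl P p))) => [|a {}p q||x {}p IH].
- exact: gl_linearr.
- by rewrite !gl_linearr scalerBr opprD addrACA.
- by rewrite !gl1 (lin0 (gl_linearr P)) (lin0 (gl_linearr Q)) subrr.
rewrite !(gl_mul, linD (gl_linearr _)) IH gl_act_comm (linB (@sym_in_linear F L)).
exact: ringE.
Qed.

(* In the induced module, an element A of the opposite nilradical acts on a
   product of elements x_i of the nilradical by moving it to the right past each
   x_i: the commutator of A and x_i is A x_i in gl, which acts on the generator
   by the character c tr. *)
Variable c : F.

Definition dop (A : L) (p : S) : S :=
  \sum_(i < n) (c * \tr (mx A *m mx b`_i) *: mderiv i p
                + 2^-1 *: gl (mx A *m mx b`_i) (mderiv i p)).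

Lemma dop_linearr A : linear (dop A).
Proof.
move=> a p q; rewrite /dop scaler_sumr -big_split; apply: eq_bigr => i _ /=.
rewrite linearP /= gl_linearr !scalerDr !scalerA.
by rewrite ![_ * a]mulrC addrACA.
Qed.

Lemma dop_linearl p : linear (dop^~ p).
Proof.
move=> a A B; rewrite /dop scaler_sumr -big_split; apply: eq_bigr => i _ /=.
rewrite mx_linear mulmxDl -scalemxAl linearP /= gl_linearl !scalerDr mulrDr scalerDl.
by rewrite !scalerA (mulrCA c) ![_ * a]mulrC addrACA.
Qed.

Lemma dop1 A : dop A 1 = 0.
Proof.
rewrite /dop big1 // => i _; rewrite mderivC (lin0 (gl_linearr _)) !scaler0.
exact: addr0.
Qed.

Let half2 : 2^-1 + 2^-1 = 1 :> F.
Proof. by rewrite [RHS]splitr !mul1r. Qed.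

(** Half of [gl (mx A *m mx x) p] arises when the derivative hits x, the other half when [gl] does.
    The two agree by [gl_act_mulC], which explains the factor 1/2 in [dop]. *)
Lemma dop_mul A x p : dop A (sym_in x * p) =
  sym_in x * dop A p + (gl (mx A *m mx x) p + c * \tr (mx A *m mx x) *: p).
Proof.
have trE : c * \tr (mx A *m mx x) *: p =
    \sum_(i < n) coord b i x *: (c * \tr (mx A *m mx b`_i) *: p).
  apply: (@linear_coord _ (fun x => c * \tr (mx A *m mx x) *: p)) => a y z.
  by rewrite mx_linear mulmxDr -scalemxAr linearP /= mulrDr scalerDl mulrCA scalerA.
have glE : gl (mx A *m mx x) p =
    \sum_(i < n) coord b i x *: gl (mx A *m mx b`_i) p.
  apply: (@linear_coord _ (fun x => gl (mx A *m mx x) p)) => a y z.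
  by rewrite mx_linear mulmxDr -scalemxAr gl_linearl.
have -> : gl (mx A *m mx x) p = 2^-1 *: gl (mx A *m mx x) p
    + 2^-1 *: \sum_(i < n) sym_in (gl_act (mx A *m mx b`_i) x) * mderiv i p.
  have -> : \sum_(i < n) sym_in (gl_act (mx A *m mx b`_i) x) * mderiv i p =
      gl (mx A *m mx x) p.
    by rewrite /gl; apply: eq_bigr => i _; rewrite gl_act_mulC.
  by rewrite -scalerDl half2 scale1r.
rewrite trE glE /dop !scaler_sumr mulr_sumr -!big_split; apply: eq_bigr => i _ /=.
rewrite mderivM mderiv_sym_in mul_mpolyC.
rewrite !(linD (gl_linearr _)) (linZ (gl_linearr _)) gl_mul.
rewrite !scalerDr mulrDr -!scalerAr !scalerA.
rewrite [_ * coord b i x]mulrC [2^-1 * coord b i x]mulrC.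
have ringE (T : comNzRingType) (u1 u2 u3 u4 u5 : T) :
    u1 + u2 + (u3 + (u4 + u5)) = u2 + u5 + (u3 + u4 + u1) by ring.
exact: ringE.
Qed.

(* The action of gl(V) on the opposite nilradical. *)
Definition nil_act (P : 'M[F]_N) (A : L) : L := lift (P *m mx A + mx A *m adj P).

Lemma mx_nil_act P A : mx (nil_act P A) = P *m mx A + mx A *m adj P.
Proof.
apply: mx_lift; rewrite (linD adj_linear) !adjM adjK adj_mx.
by rewrite mulmxN mulNmx -opprD addrC.
Qed.

Lemma nil_act_mx x y : nil_act (mx x) y = bracket x y.
Proof. by apply: mx_inj; rewrite mx_nil_act mx_bracket adj_mx mulmxN. Qed.

(** Equivariance of [dop] under gl(V). The commutator of P with A x is A (P x) + (P A) x, where P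
    acts on x by [gl_act] and on A by [nil_act]. *)
Lemma gl_dop P A p : gl P (dop A p) = dop A (gl P p) + dop (nil_act P A) p.
Proof.
apply: (operator_ext (f := fun p => gl P (dop A p))
  (g := fun p => dop A (gl P p) + dop (nil_act P A) p)) => [a {}p q|a {}p q||x {}p IH].
- by rewrite dop_linearr gl_linearr.
- by rewrite gl_linearr !dop_linearr scalerDr addrACA.
- by rewrite gl1 !dop1 (lin0 (gl_linearr _)) (lin0 (dop_linearr _)) addr0.
set B := nil_act P A; set y := gl_act P x.
have matE : P *m (mx A *m mx x) - mx A *m mx x *m P = mx A *m mx y + mx B *m mx x.
  rewrite /B /y mx_nil_act mx_gl_act mulmxN mulmxDr mulmxDl !mulmxA opprD.
  by rewrite [RHS]addrC addrA addrK.
have glE : gl P (gl (mx A *m mx x) p) =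
    gl (mx A *m mx x) (gl P p) + (gl (mx A *m mx y) p + gl (mx B *m mx x) p).
  by rewrite -(linD (gl_linearl p)) -matE gl_comm [RHS]addrC subrK.
(* A commutator has trace zero, so the two contributions of the character cancel. *)
have trE : \tr (mx B *m mx x) = - \tr (mx A *m mx y).
  by apply/eqP; rewrite -addr_eq0 addrC -linearD -matE linearB /= mxtrace_mulC subrr.
rewrite !(dop_mul, gl_mul, linD (gl_linearr _), linD (dop_linearr _)).
rewrite (linZ (gl_linearr _)) -/y -/B glE IH trE mulrN scaleNr.
have ringE (T : comNzRingType) (a d e f g h i j u v : T) :
    v * a + u * (d + e) + (f + (g + h) + i) =
    v * a + (g + j) + (u * d + (f + i)) + (u * e + (h - j)) by ring.
exact: ringE.
Qed.

(** The opposite nilradical is abelian. The commutators with x reduce this to the symmetry of A x B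
    + B x A in A and B. *)
Lemma dopC A B p : dop A (dop B p) = dop B (dop A p).
Proof.
apply: (operator_ext (f := fun p => dop A (dop B p))
  (g := fun p => dop B (dop A p))) => [a {}p q|a {}p q||x {}p IH].
- by rewrite !dop_linearr.
- by rewrite !dop_linearr.
- by rewrite !dop1 (lin0 (dop_linearr A)) (lin0 (dop_linearr B)).
rewrite !(dop_mul, linD (dop_linearr _), linZ (dop_linearr _)) IH !gl_dop.
have -> : nil_act (mx B *m mx x) A = nil_act (mx A *m mx x) B.
  apply: mx_inj; rewrite !mx_nil_act !adjM !adj_mx.
  by rewrite !(mulNmx, mulmxN, opprK) !mulmxA addrC.
have ringE (T : comNzRingType) (a d e f g h i : T) :
    a + (d + e + f) + (g + h) = a + (g + e + h) + (d + f) by ring.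
exact: ringE.
Qed.

(** * The action of the first factor of sp(V) + sp(V) *)

Definition half_defect (x : L) (p : S) : S :=
  2^-1 *: gl (mx x) p + (2^-1 * 2^-1) *: dop x p.

Lemma half_defect_linearr x : linear (half_defect x).
Proof.
move=> a p q; rewrite /half_defect gl_linearr dop_linearr !scalerDr !scalerA.
by rewrite ![_ * a]mulrC addrACA.
Qed.

Lemma half_defect_linearl p : linear (half_defect^~ p).
Proof.
move=> a x y; rewrite /half_defect mx_linear gl_linearl dop_linearl !scalerDr !scalerA.
by rewrite ![_ * a]mulrC addrACA.
Qed.

Lemma bracketC (x y : L) : bracket y x = - bracket x y.
Proof. by apply: mx_inj; rewrite (linN mx_linear) !mx_bracket opprB. Qed.

Local Notation r := (deformed_act half_defect).

Lemma half_defect_bracket x y p : r (bracket x y) p = r x (r y p) - r y (r x p).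
Proof.
rewrite /deformed_act /half_defect; move: 2^-1 half2 => a a2.
rewrite !(gl_mul, dop_mul, linD (gl_linearr _), linD (dop_linearr _),
  linZ (gl_linearr _), linZ (dop_linearr _)) !gl_dop !gl_act_mx !nil_act_mx.
rewrite (bracketC x y) (linN (@sym_in_linear F L)) (linN (dop_linearl p)).
rewrite (dopC y x) (mxtrace_mulC (mx y)).
have glE : gl (mx x *m mx y) p = gl (mx y *m mx x) p + gl (mx (bracket x y)) p.
  by rewrite -(linD (gl_linearl p)) mx_bracket addrC subrK.
rewrite glE mx_bracket gl_comm.
apply: half_bracket_identity a2.
Qed.

Lemma msize_gl P p d : (msize p <= d.+1)%N -> (msize (gl P p) <= d.+1)%N.
Proof.
move=> pd; rewrite /gl; apply: (big_ind (fun q : S => (msize q <= d.+1)%N)).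
- by rewrite msize0.
- move=> q q' qd q'd; apply: leq_trans (msizeD_le _ _) _.
  by rewrite geq_max qd.
- by move=> i _; apply: msize_mul_sym_in; apply: msize_mderiv.
Qed.

Lemma msize_dop A p d : (msize p <= d.+1)%N -> (msize (dop A p) <= d)%N.
Proof.
move=> pd; have pdi i : (msize (mderiv i p) <= d)%N by apply: msize_mderiv.
rewrite /dop; apply: (big_ind (fun q : S => (msize q <= d)%N)).
- by rewrite msize0.
- move=> q q' qd q'd; apply: leq_trans (msizeD_le _ _) _.
  by rewrite geq_max qd.
move=> i _; apply: (lin_closed_msize F n d).2 => //.
apply: leq_trans (msizeZ_le _ _) _.
case: d pdi {pd} => [|d] pdi; last exact: msize_gl.
have /eqP -> : mderiv i p == 0 by rewrite -msize_poly_eq0 -leqn0.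
by rewrite (lin0 (gl_linearr _)) msize0.
Qed.

Lemma msize_half_defect x p d : (msize p <= d)%N -> (msize (half_defect x p) <= d)%N.
Proof.
case: d => [|d] pd.
  have /eqP -> : p == 0 by rewrite -msize_poly_eq0 -leqn0.
  by rewrite (lin0 (half_defect_linearr _)) msize0.
rewrite /half_defect; apply: (lin_closed_msize F n d.+1).2; first exact: msize_gl.
apply: leq_trans (msizeZ_le _ _) _.
by apply: ltnW; apply: msize_dop.
Qed.

(** * The ideal of the C_2-algebra is a submodule *)

Variables (e h : L) (k : nat).
Hypothesis cE : c = k%:R.
Hypothesis e_rank1 : forall a, mx e *m mx a *m mx e = \tr (mx a *m mx e) *: mx e.
Hypothesis e_orbit : forall P, exists x, gl_act P e = bracket x e.
Hypothesis he : mx h *m mx e = mx e.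
Hypothesis eh : mx e *m mx h = - mx e.

Local Notation W := (submodule_gen (sym_in e ^+ k.+1)).
Local Notation J := (ideal_gen W).

(** By definition W is stable under sp(V) only. By [e_orbit], gl(V) moves e in directions along
    which sp(V) already moves it, so it sends the generator into W. *)
Lemma submodule_gl w : W w -> forall P, W (gl P w).
Proof.
have [W0 WD WA] := submodule_gen_submodule (sym_in e ^+ k.+1).
move=> Ww; apply: (Ww (fun w => W w /\ forall P, W (gl P w)) _ _).2.
  split=> [|a p q [Wp pP] [Wq qP]|x p [Wp pP]].
  - by split=> // P; rewrite (lin0 (gl_linearr _)).
  - by split=> [|P]; [apply: WD | rewrite gl_linearr; apply: WD].
  - split=> [|P]; first exact: WA.
    (* P x = [P, x] + x P, and the induction hypothesis covers the element [P, x] of gl(V) as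
       well. *)
    rewrite -gl_sym_act -[gl P _](subrK (gl (mx x) (gl P p))) -gl_comm.
    by rewrite -[gl (_ - _) _]scale1r gl_sym_act; apply: WD; [apply: pP | apply: WA].
split=> [|P]; first exact: submodule_gen_self.
have [x xE] := e_orbit P.
have -> : gl P (sym_in e ^+ k.+1) = sym_act x (sym_in e ^+ k.+1).
  elim: (k.+1) => [|j IH]; first by rewrite !expr0 -gl_sym_act !gl1.
  by rewrite !exprS glM sym_actM IH gl_sym_in sym_act_in xE.
by apply: WA; apply: submodule_gen_self.
Qed.

Lemma ideal_gl p : J p -> forall P, J (gl P p).
Proof.
have [J0 JD JMl JMr] := ideal_gen_ideal W.
move=> Jp; apply: (Jp (fun p => J p /\ forall P, J (gl P p)) _ _).2 => [|w Ww].
  split=> [|x y [Jx xP] [Jy yP]|x y [Jy yP]|x y [Jx xP]].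
  - by split=> // P; rewrite (lin0 (gl_linearr _)).
  - by split=> [|P]; rewrite ?(linD (gl_linearr _)); apply: JD.
  - split=> [|P]; first exact: JMl.
    by rewrite glM; apply: JD; apply: JMl.
  - split=> [|P]; first exact: JMr.
    by rewrite glM; apply: JD; apply: JMr.
by split=> [|P]; apply: ideal_gen_sub => //; apply: submodule_gl.
Qed.

(** Since e has rank one, e A e = tr(A e) e, so e is an eigenvector of A e with eigenvalue -2 tr(A
    e). *)
Lemma gl_gen A j : gl (mx A *m mx e) (sym_in e ^+ j) =
  (- (2 * j%:R * \tr (mx A *m mx e))) *: sym_in e ^+ j.
Proof.
have eE : gl_act (mx A *m mx e) e = (- (2 * \tr (mx A *m mx e))) *: e.
  apply: mx_inj; rewrite mx_gl_act (linZ mx_linear) adjM !adj_mx mulNmx mulmxN opprK.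
  by rewrite mulmxA e_rank1 -scalerDl scaleNr mulrDl mul1r.
elim: j => [|j IH]; first by rewrite !expr0 gl1 mulr0 mul0r oppr0 scale0r.
rewrite exprS gl_mul IH eE (linZ (@sym_in_linear F L)) -scalerAl -scalerAr -scalerDl.
by congr (_ *: _); rewrite -[j.+1]addn1 natrD; ring.
Qed.

(* For c = k the scalar vanishes at j = k: the highest weight was chosen so that
   e^(k+1) is a singular vector. *)
Lemma dop_gen A j : dop A (sym_in e ^+ j.+1) =
  (j.+1%:R * (c - j%:R) * \tr (mx A *m mx e)) *: sym_in e ^+ j.
Proof.
elim: j => [|j IH]; rewrite exprS dop_mul gl_gen.
  rewrite expr0 dop1 mulr0 add0r -scalerDl; congr (_ *: _); ring.
rewrite IH -scalerAr -exprS -!scalerDl; congr (_ *: _).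
by rewrite -[j.+2]addn1 -[j.+1]addn1 !natrD; ring.
Qed.

(** The generator is singular by the choice of the character, and by [gl_dop] the vectors killed by
    every [dop A] form an L-submodule. *)
Lemma dop_submodule w : W w -> forall A, dop A w = 0.
Proof.
move=> Ww; apply: (Ww (fun w => forall A, dop A w = 0)) => [|A]; last first.
  by rewrite dop_gen cE subrr mulr0 mul0r scale0r.
split=> [A|a p q pE qE A|x p pE A].
- exact: (lin0 (dop_linearr _)).
- by rewrite dop_linearr pE qE scaler0 addr0.
- have := gl_dop (mx x) A p; rewrite !pE (lin0 (gl_linearr _)) addr0 gl_sym_act.
  by move->.
Qed.

(** [dop A] is of second order, not a derivation. It passes one variable at a time, and the
    commutators, in gl(V) plus scalars, preserve J. *)
Lemma ideal_dop p : J p -> forall A, J (dop A p).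
Proof.
have [J0 JD JMl JMr] := ideal_gen_ideal W.
have [_ JL] := ideal_lin_closed (ideal_gen_ideal W).
pose K p := J p /\ forall A, J (dop A p).
have KL : lin_closed K.
  split=> [|a x y [Jx xA] [Jy yA]].
    by split=> // A; rewrite (lin0 (dop_linearr _)).
  by split=> [|A]; rewrite ?dop_linearr; apply: JL.
have KM x y : K y -> K (x * y).
  move=> Ky; apply: (@mpoly_mul_ind _ _ (fun x => K (x * y))) => [||i {}x].
  - by apply: lin_closed_comp KL => a u v; rewrite mulrDl -scalerAl.
  - by rewrite mul1r.
  rewrite -mulrA -(sym_in_basis i); move: (x * y) => z [Jz zA].
  split=> [|A]; first exact: JMl.
  rewrite dop_mul; apply: (JD _ _); first exact: JMl.
  apply: (JD _ _); first exact: ideal_gl.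
  by rewrite -[_ *: z]addr0; apply: JL.
move=> Jp; apply: (Jp K _ _).2 => [|w Ww].
  split=> [|x y Kx Ky|x y|x y Kx].
  - exact: KL.1.
  - by rewrite -[x]scale1r; apply: KL.2.
  - exact: KM.
  - by rewrite mulrC; apply: KM.
split=> [|A]; first exact: ideal_gen_sub.
by rewrite dop_submodule.
Qed.

Lemma half_ideal x p : J p -> J (r x p).
Proof.
have [J0 JD JMl JMr] := ideal_gen_ideal W.
have [_ JL] := ideal_lin_closed (ideal_gen_ideal W).
move=> Jp; rewrite /deformed_act /half_defect; apply: JD; first exact: JMl.
apply: (JL _ _ _); first exact: ideal_gl.
by rewrite -[_ *: _]addr0; apply: JL => //; apply: ideal_dop.
Qed.

(** * Conjugation of the operator of e to the multiplication by e *)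

Let tr_e : \tr (mx e) = 0.
Proof.
have := tr_adj (mx e); rewrite adj_mx linearN /= => /eqP.
by rewrite eq_sym -addr_eq0 -mulr2n mulrn_eq0 /= => /eqP.
Qed.

(** Bracketing with [dop h] sends the multiplication by e to gl e, then to 2 dop e, then to 0. Thus
    exp(t ad (dop h)) sends e to e + t gl e + t^2 dop e, which at t = 1/2 is the operator of e. *)
Lemma dop_h_mul p : dop h (sym_in e * p) = sym_in e * dop h p + gl (mx e) p.
Proof. by rewrite dop_mul he tr_e mulr0 scale0r addr0. Qed.

Lemma dop_h_gl p : dop h (gl (mx e) p) = gl (mx e) (dop h p) + 2 *: dop e p.
Proof.
rewrite gl_dop nil_act_mx.
have -> : bracket e h = (-2) *: e.
  apply: mx_inj; rewrite mx_bracket (linZ mx_linear) he eh -opprD.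
  by rewrite -mulr2n -scaler_nat scaleNr.
by rewrite (linZ (dop_linearl p)) -addrA -scalerDl addNr scale0r addr0.
Qed.

(* [pow_coeff d j] is the coefficient of t^j in (e + t gl e + t^2 dop e)^d, where
   the base is exp(t ad (dop h)) applied to the multiplication by e. *)
Fixpoint pow_coeff (d j : nat) (p : S) : S :=
  if d is d'.+1 then
    sym_in e * pow_coeff d' j p
    + ((if j is j'.+1 then gl (mx e) (pow_coeff d' j' p) else 0)
    + (if j is j'.+2 then dop e (pow_coeff d' j' p) else 0))
  else if j is 0 then p else 0.

(** Coefficient of t^j in the equation saying that the t-derivative of the power is its commutator
    with [dop h]. *)
Lemma pow_coeff_dop d j p : dop h (pow_coeff d j p) =
  j.+1%:R *: pow_coeff d j.+1 p + pow_coeff d j (dop h p).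
Proof.
have D0 := lin0 (dop_linearr h); have DD := linD (dop_linearr h).
elim: d j => [|d IH] j; first by case: j => [|j] /=; rewrite ?D0 scaler0 add0r.
have ring0 (T : comNzRingType) (x u v w : T) :
    x * (u + v) + w + (0 + 0) = x * u + (w + 0) + (x * v + (0 + 0)) by ring.
have ring1 (T : comNzRingType) (x u v w y z : T) :
    x * (u *+ 2 + v) + w + (w + y + z *+ 2 + 0) =
    (x * u + (w + z)) *+ 2 + (x * v + (y + 0)) by ring.
have ring2 (T : comNzRingType) (i : nat) (x u v w y z t : T) :
    x * (u *+ i.+3 + v) + w + (w *+ i.+2 + y + z *+ 2 + (z *+ i.+1 + t)) =
    (x * u + (w + z)) *+ i.+3 + (x * v + (y + t)) by ring.
case: j => [|[|j]] /=; rewrite !DD ?D0 dop_h_mul ?dop_h_gl ?(dopC h e) !IH.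
- by rewrite !scale1r; exact: ring0.
- rewrite scale1r (linD (gl_linearr _)) !scaler_nat; exact: ring1.
- rewrite !(linD (gl_linearr _)) !(linD (dop_linearr e)).
  rewrite (linZ (gl_linearr _)) (linZ (dop_linearr e)) !scaler_nat; exact: ring2.
Qed.

(** Evaluation at t = 1/2. The power has degree at most 2d in t, so the bound on [B] includes all
    its coefficients. *)
Lemma pow_coeff_sum d p B : (d.*2 < B)%N ->
  iter d (r e) p = \sum_(0 <= j < B) (2^-1 ^+ j) *: pow_coeff d j p.
Proof.
elim: d B => [|d IH] B dB.
  case: B dB => // B _; rewrite big_nat_recl // expr0 scale1r big1 ?addr0 // => j _.
  by rewrite scaler0.
case: B dB => [|[|B]] // dB; rewrite iterS.
rewrite doubleS !ltnS in dB; have dB1 : (d.*2 < B.+1)%N := ltnW dB.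
have dB2 : (d.*2 < B.+2)%N := ltnW dB1.
have glE : \sum_(0 <= j < B.+1) (2^-1 ^+ j.+1) *: gl (mx e) (pow_coeff d j p) =
    2^-1 *: gl (mx e) (iter d (r e) p).
  rewrite (IH B.+1 dB1) (lin_sum (gl_linearr _)) scaler_sumr.
  by apply: eq_bigr => j _; rewrite (linZ (gl_linearr _)) scalerA exprS.
have dopE : \sum_(0 <= j < B) (2^-1 ^+ j.+2) *: dop e (pow_coeff d j p) =
    (2^-1 * 2^-1) *: dop e (iter d (r e) p).
  rewrite (IH B dB) (lin_sum (dop_linearr _)) scaler_sumr.
  by apply: eq_bigr => j _; rewrite (linZ (dop_linearr _)) scalerA !exprS mulrA.
have splitE j : (2^-1 ^+ j) *: pow_coeff d.+1 j p =
    sym_in e * ((2^-1 ^+ j) *: pow_coeff d j p)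
    + ((2^-1 ^+ j) *: (if j is j'.+1 then gl (mx e) (pow_coeff d j' p) else 0)
    + (2^-1 ^+ j) *: (if j is j'.+2 then dop e (pow_coeff d j' p) else 0)).
  by rewrite /= !scalerDr scalerAr.
under eq_bigr => j _ do rewrite splitE.
rewrite !big_split /= -mulr_sumr -(IH B.+2 dB2).
rewrite big_nat_recl // scaler0 add0r glE.
by rewrite big_nat_recl // big_nat_recl // !scaler0 !add0r dopE.
Qed.

(** The coefficient for j = 0 is the multiplication by e^(k+1). In characteristic 0 [pow_coeff_dop]
    gives each next one from the previous, and [dop h] preserves J. *)
Lemma ideal_pow_coeff j p : J (pow_coeff k.+1 j p).
Proof.
have [J0 JD JMl JMr] := ideal_gen_ideal W.
have [_ JL] := ideal_lin_closed (ideal_gen_ideal W).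
elim: j p => [|j IH] p.
  have -> : pow_coeff k.+1 0 p = sym_in e ^+ k.+1 * p.
    by elim: k.+1 => [|d IH] /=; rewrite ?mul1r // IH !addr0 exprS mulrA.
  by apply: JMr; apply: ideal_gen_sub; apply: submodule_gen_self.
have jE : pow_coeff k.+1 j.+1 p = j.+1%:R^-1 *:
    (dop h (pow_coeff k.+1 j p) - pow_coeff k.+1 j (dop h p)).
  by rewrite pow_coeff_dop addrK scalerA mulVf ?scale1r // pnatr_eq0.
rewrite jE -[_ *: _]addr0; apply: (JL _ _ _) => //.
by rewrite addrC -scaleN1r; apply: (JL _ _ _) => //; apply: ideal_dop.
Qed.

Lemma half_gen p : J (iter k.+1 (r e) p).
Proof.
rewrite (pow_coeff_sum _ (ltnSn _)).
apply: (lin_closed_sum _ (ideal_lin_closed (ideal_gen_ideal W))) => j _ _.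
exact: ideal_pow_coeff.
Qed.

Theorem same_dim_c2_zhu : same_dim (c2_alg e k) (zhu_alg e k).
Proof.
apply: (same_dim_of_deformation half_defect_linearl half_defect_linearr
  msize_half_defect half_defect_bracket half_ideal half_gen).
Qed.

End Operators.

(** * The symplectic Lie algebra *)

Section SymplecticAdjoint.
Variables (F : fieldType) (m : nat).
Local Notation M := 'M[F]_(m + m).
Local Notation J := (sympl_form F m).

(** The adjoint J^-1 P^T J for the symplectic form, with J^-1 = -J; sp(V) consists of the matrices
    with adjoint -P. *)
Definition sympl_adj (P : M) : M := - (J *m P^T *m J).

Lemma sympl_form_sqr : J *m J = - 1%:M.
Proof.
rewrite /sympl_form mulmx_block !mul0mx !mulmx0 !add0r !addr0 mul1mx mulmx1.
by rewrite -[X in - X]/(1%:M) (scalar_mx_block m m) opp_block_mx !oppr0.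
Qed.

Lemma tr_sympl_form : J^T = - J.
Proof.
rewrite /sympl_form tr_block_mx !trmx0 linearN /= trmx1 opp_block_mx !oppr0.
by rewrite opprK.
Qed.

Lemma sympl_adj_linear : linear sympl_adj.
Proof.
move=> a P Q; rewrite /sympl_adj linearP /= mulmxDr mulmxDl -scalemxAr -scalemxAl.
by rewrite opprD scalerN.
Qed.

Lemma sympl_adjM P Q : sympl_adj (P *m Q) = sympl_adj Q *m sympl_adj P.
Proof.
rewrite /sympl_adj mulNmx mulmxN opprK trmx_mul !mulmxA.
by rewrite -(mulmxA _ J J) sympl_form_sqr mulmxN mulmx1 !mulNmx.
Qed.

Lemma sympl_adjK P : sympl_adj (sympl_adj P) = P.
Proof.
rewrite /sympl_adj linearN /= !trmx_mul trmxK tr_sympl_form !(mulNmx, mulmxN, opprK).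
rewrite !mulmxA sympl_form_sqr mulNmx mul1mx -mulmxA sympl_form_sqr.
by rewrite mulmxN mulmx1 !opprK.
Qed.

Lemma mxtrace_sympl_adj P : \tr (sympl_adj P) = \tr P.
Proof.
rewrite /sympl_adj linearN /= mxtrace_mulC mulmxA sympl_form_sqr mulNmx mul1mx.
by rewrite linearN /= opprK mxtrace_tr.
Qed.

Lemma sympl_adj_sp (x : sp F m) : sympl_adj (sp_mx x) = - sp_mx x.
Proof.
rewrite /sympl_adj -mulmxA sp_mxE mulmxN mulmxA sympl_form_sqr opprK.
by rewrite mulNmx mul1mx.
Qed.

Definition to_sp (P : M) : sp F m := vsproj (sp_space F m) P.

Lemma sp_mxK P : sympl_adj P = - P -> sp_mx (to_sp P) = P.
Proof.
move=> adjP; rewrite /sp_mx /to_sp vsprojK // mem_sp.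
have {2}<- : J *m P^T *m J = P by apply: oppr_inj.
by rewrite !mulmxA sympl_form_sqr !mulNmx mul1mx addrN.
Qed.

Lemma sp_mx_linear : linear (@sp_mx F m).
Proof. by move=> a x y; rewrite /sp_mx linearP. Qed.


Lemma sympl_adj_block (A B C D : 'M[F]_m) :
  sympl_adj (block_mx A B C D) = block_mx D^T (- B^T) (- C^T) A^T.
Proof.
rewrite /sympl_adj tr_block_mx /sympl_form !mulmx_block.
rewrite !(mul0mx, mulmx0, mul1mx, mulmx1, add0r, addr0, mulNmx, mulmxN).
by rewrite opp_block_mx !opprK.
Qed.

End SymplecticAdjoint.

(** * Highest root vectors of the symplectic Lie algebra *)

Section HighestRoot.
Variables (F : numFieldType) (m : nat).
Local Notation M := 'M[F]_(m.+1 + m.+1).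
Local Notation E00 := (delta_mx 0 0 : 'M[F]_m.+1).
Local Notation Epp := (block_mx E00 0 0 0 : M).
Local Notation Epq := (block_mx 0 E00 0 0 : M).
Local Notation Eqp := (block_mx 0 0 E00 0 : M).
Local Notation Eqq := (block_mx 0 0 0 E00 : M).
Local Notation adj := (@sympl_adj F m.+1).

Let mul_block0 := (mul0mx, mulmx0, add0r, addr0).

Lemma delta00_sandwich (X : 'M[F]_m.+1) : E00 *m X *m E00 = X 0 0 *: E00.
Proof.
pose u : 'cV[F]_m.+1 := delta_mx 0 0; pose v : 'rV[F]_m.+1 := delta_mx 0 0.
have uv : E00 = u *m v by rewrite mul_delta_mx.
rewrite {1 2}uv !mulmxA -(mulmxA u v) -(mulmxA u) -rowE -colE.
have -> : col 0 (row 0 X) = (X 0 0)%:M.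
  by apply/matrixP => i j; rewrite !ord1 !mxE eqxx.
by rewrite mul_mx_scalar -scalemxAl uv.
Qed.

Lemma mxtrace_delta00 (X : 'M[F]_m.+1) : \tr (X *m E00) = X 0 0.
Proof.
rewrite -(mul_delta_mx (0 : 'I_m.+1) 0 0) mulmxA mxtrace_mulC mulmxA.
rewrite delta00_sandwich linearZ /= /mxtrace (bigD1 0) //= mxE eqxx.
rewrite big1 ?addr0 ?mulr1 // => i i0.
by rewrite mxE (negbTE i0).
Qed.

Lemma highest_root_rank1 (X : M) : Epq *m X *m Epq = \tr (X *m Epq) *: Epq.
Proof.
rewrite -[X]submxK; move: (ulsubmx X) (ursubmx X) (dlsubmx X) (drsubmx X) => A B C D.
rewrite !mulmx_block !mul_block0 mxtrace_block mxtrace0 add0r mxtrace_delta00.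
by rewrite delta00_sandwich scale_block_mx !scaler0.
Qed.

(** Under the identification of sp(V) with S^2 V, [Epq] is, up to a scalar, the square of a nonzero
    vector v, and sp(V) v = V, so gl(V) moves v in no new direction. *)
Lemma highest_root_orbit (P : M) : exists2 X : M, adj X = - X &
  - (adj P *m Epq + Epq *m P) = X *m Epq - Epq *m X.
Proof.
have adjpp : adj Epp = Eqq by rewrite sympl_adj_block trmx_delta !trmx0 !oppr0.
have adjqq : adj Eqq = Epp by rewrite sympl_adj_block trmx_delta !trmx0 !oppr0.
have adjpq : adj Epq = - Epq.
  by rewrite sympl_adj_block trmx_delta !trmx0 opp_block_mx !oppr0.
have adjqp : adj Eqp = - Eqp.
  by rewrite sympl_adj_block trmx_delta !trmx0 opp_block_mx !oppr0.
set a := dlsubmx P 0 0.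
have qPpq : Eqq *m P *m Epq = a *: Eqq.
  rewrite /a -[P]submxK block_mxKdl.
  rewrite !mulmx_block !mul_block0 delta00_sandwich scale_block_mx.
  by rewrite !scaler0.
have pqPp : Epq *m adj P *m Epp = - (a *: Epp).
  have := congr1 adj qPpq; rewrite !sympl_adjM adjpq adjqq mulmxA.
  rewrite (linZ (@sympl_adj_linear _ _)) adjqq mulNmx.
  by move=> /(congr1 -%R); rewrite !mulNmx opprK.
(* The first two terms form a skew matrix with the required bracket up to multiples of [Eqq] and
   [Epp]; the multiple of [Eqp] cancels these. *)
exists (Eqq *m P - adj P *m Epp - a *: Eqp).
  rewrite !(linB (@sympl_adj_linear _ _)) (linZ (@sympl_adj_linear _ _)) !sympl_adjM.
  rewrite sympl_adjK adjpp adjqq adjqp scalerN !opprB opprK addrC.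
  by rewrite [_ - Eqq *m P]addrC.
rewrite !mulmxBl !mulmxBr qPpq !mulmxA pqPp -!scalemxAl -!scalemxAr.
rewrite -!(mulmxA (adj P)) !mulmx_block.
rewrite !mul_block0 !mul_delta_mx.
by rewrite opprK addrK [X in X - _]addrAC subrr add0r opprD.
Qed.

Lemma sympl_adj_blockP (A B C D : 'M[F]_m.+1) :
  adj (block_mx A B C D) = - block_mx A B C D ->
  [/\ D = - A^T, B^T = B & C^T = C].
Proof.
rewrite sympl_adj_block opp_block_mx => /eq_block_mx[DA /oppr_inj BB /oppr_inj CC _].
by split=> //; rewrite -[D]trmxK DA linearN.
Qed.

Lemma two_eq0 (a : F) : a + a = 0 -> a = 0.
Proof. by move=> /eqP; rewrite -mulr2n mulrn_eq0 => /eqP. Qed.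

Lemma delta_mulE (i j k l : 'I_m.+1) (X : 'M[F]_m.+1) :
  (delta_mx i j *m X) k l = X j l *+ (k == i).
Proof.
rewrite mxE (bigD1 j) //= big1 => [|a aj]; last by rewrite mxE (negbTE aj) andbF mul0r.
by rewrite addr0 mxE eqxx andbT mulr_natl.
Qed.

Lemma mul_deltaE (i j k l : 'I_m.+1) (X : 'M[F]_m.+1) :
  (X *m delta_mx i j) k l = X k i *+ (l == j).
Proof.
rewrite mxE (bigD1 i) //= big1 => [|a ai]; last by rewrite mxE (negbTE ai) mulr0.
by rewrite addr0 mxE eqxx mulr_natr.
Qed.

Lemma highest_root_vectorE (e : sp F m.+1) :
  highest_root_vector e -> exists2 a, a != 0 & sp_mx e = a *: Epq.
Proof.
case=> e0 _ npe; have npE (X : M) : adj X = - X -> dlsubmx X = 0 ->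
    (forall i j : 'I_m.+1, (j <= i)%N -> ulsubmx X i j = 0) ->
    X *m sp_mx e = sp_mx e *m X.
  move=> adjX Xdl Xul; have XE := sp_mxK adjX.
  have := npe (to_sp X); rewrite /sp_npos XE => /(_ (conj Xdl Xul)).
  move=> /(congr1 (@sp_mx F m.+1)); rewrite sp_bracketE /commutator XE.
  by rewrite (lin0 (@sp_mx_linear F m.+1)) => /eqP; rewrite subr_eq0 => /eqP.
have := sympl_adj_sp e; have: sp_mx e != 0.
  by rewrite -(lin0 (@sp_mx_linear F m.+1)) (inj_eq val_inj).
move: (sp_mx e) npE => E npE; rewrite -[E]submxK in npE *.
move: (ulsubmx E) (ursubmx E) (dlsubmx E) (drsubmx E) npE => A B C D npE E0.
move=> /sympl_adj_blockP[DA BB CC].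
have urE (S : 'M[F]_m.+1) : S^T = S -> S *m C = 0 /\ S *m D = A *m S.
  move=> ST; have := npE (block_mx 0 S 0 0).
  rewrite sympl_adj_block !trmx0 ST opp_block_mx !oppr0 block_mxKdl block_mxKul.
  move=> /(_ erefl erefl (fun i j _ => mxE _ _ _ _)).
  by rewrite !mulmx_block !mul_block0 => /eq_block_mx[].
(* S = 1 gives C = 0 and A = D. With D = -A^T the diagonal of A vanishes, and the matrices S = E_ii
   remove the other entries. *)
have [C0 AD] := urE 1%:M (trmx1 _ _); rewrite !mul1mx mulmx1 in C0 AD.
have A0 : A = 0.
  apply/matrixP => i j; rewrite [RHS]mxE.
  have [->|ji] := eqVneq j i.
    apply: two_eq0; rewrite -[X in X + _](congr1 (fun X : 'M_m.+1 => X i i) AD).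
    by rewrite DA !mxE addNr.
  have [_ /matrixP/(_ i j)] := urE (delta_mx i i) (trmx_delta F i i).
  by rewrite delta_mulE mul_deltaE eqxx (negbTE ji) AD.
have D0 : D = 0 by rewrite AD.
have Bj j l : j != 0 -> B j l = 0.
  (* Test against the root vector of e_0 - e_j: only the entry B_00 survives. *)
  move=> j0; have := npE (block_mx (delta_mx 0 j) 0 0 (- delta_mx j 0)).
  rewrite sympl_adj_block linearN /= !trmx_delta !trmx0 opp_block_mx !oppr0 opprK.
  rewrite block_mxKdl block_mxKul => /(_ erefl erefl) H.
  have {}/H : forall i' j' : 'I_m.+1, (j' <= i')%N ->
      (delta_mx 0 j : 'M[F]_m.+1) i' j' = 0.
    move=> i' j' ji'; rewrite mxE; case: eqP => //= i0; case: eqP => //= jj.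
    by case/eqP: j0; apply/val_inj; move: ji'; rewrite i0 jj leqn0 => /eqP.
  rewrite A0 C0 D0 !mulmx_block !mul_block0 => /eq_block_mx[_ + _ _].
  move=> /matrixP/(_ 0 l); rewrite mulmxN delta_mulE eqxx mxE mul_deltaE => BE.
  have [l0|l0] := eqVneq l 0; last by move: BE; rewrite (negbTE l0) mulr1n mulr0n oppr0.
  have B0 : B 0 j = B j 0 by rewrite -{1}BB mxE.
  apply: two_eq0; move: BE; rewrite l0 eqxx !mulr1n B0 => {1}->.
  by rewrite addNr.
have BE : B = B 0 0 *: E00.
  apply/matrixP => i j; rewrite !mxE.
  have [->|i0] := eqVneq i 0; last by rewrite Bj // mulr0.
  have [->|j0] := eqVneq j 0; first by rewrite mulr1.
  by rewrite -BB mxE Bj // mulr0.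
exists (B 0 0); last by rewrite A0 C0 D0 {1}BE scale_block_mx !scaler0.
apply/eqP => b0; case/eqP: E0; rewrite A0 C0 D0 BE b0 scale0r.
exact: block_mx0.
Qed.

Lemma same_dim_c2_zhu_sp (k : nat) (e : sp F m.+1) :
  highest_root_vector e -> same_dim (c2_alg e k) (zhu_alg e k).
Proof.
move=> /highest_root_vectorE[a _ eE].
(* The coroot of the highest root. *)
pose H : M := block_mx E00 0 0 (- E00).
have hadj : adj H = - H.
  by rewrite sympl_adj_block linearN /= trmx_delta !trmx0 opp_block_mx !oppr0 opprK.
apply: (@same_dim_c2_zhu _ _ _ (@sp_mx _ _) (@to_sp _ _) (@sympl_adj _ _)
  (@sp_mx_linear _ _) val_inj (@sp_bracketE _ _) (@sympl_adj_linear _ _)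
  (@sympl_adjM _ _) (@sympl_adjK _ _) (@mxtrace_sympl_adj _ _) (@sympl_adj_sp _ _)
  (@sp_mxK _ _) k%:R e (to_sp H) k erefl).
- move=> x; rewrite eE -!(scalemxAl, scalemxAr) highest_root_rank1 mxtraceZ !scalerA.
  by rewrite -mulrA mulrC.
- move=> P; have [X XE PX] := highest_root_orbit P.
  have mx_inj : injective (@sp_mx F m.+1) := val_inj.
  exists (to_sp X); apply: mx_inj.
  have -> := mx_gl_act (@sympl_adj_linear _ _) (@sympl_adjM _ _) (@sympl_adjK _ _)
    (@sympl_adj_sp _ _) (@sp_mxK _ _) P e.
  rewrite sp_bracketE /commutator (sp_mxK XE) eE -2!scalemxAr -2!scalemxAl.
  by rewrite -scalerDr -scalerBr -scalerN PX.
- rewrite eE (sp_mxK hadj) -scalemxAr mulmx_block !mul_block0.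
  by rewrite mul_delta_mx.
- rewrite eE (sp_mxK hadj) -scalemxAl mulmx_block !mul_block0.
  by rewrite mulmxN mul_delta_mx -scalerN opp_block_mx !oppr0.
Qed.

End HighestRoot.

Theorem theorem4p1 (R : realType) (m k : nat) (hm : (1 <= m)%N)
    (e : sp R[i] m) (he : highest_root_vector e) :
  same_dim (c2_alg e k) (zhu_alg e k).
Proof. by case: m hm e he => // m _ e; apply: same_dim_c2_zhu_sp. Qed.
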